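(* Suppose that $\mathrm{char}(K)=0$, $n-m_0+\ell_0\ge 0$, $m_0\ne n+1$, and $f(x)\in K[x]$ is a degree $n$ polynomial without repeated roots. Suppose that $\mathcal C_{f,d}$ has at least $2$ packets of torsion points of order $m_0$. Then: (i) $d\le 5$. (ii) If $n<2d$, then $d\le 4$, $m_0=2d$, and $n\le 7$. (iii) If $n=7$, then $d=3$. (iv) $n\ne 5,6$. (v) If $n=4$, then $d=3$. (vi) If $n=9$, then $d=4$.
   Context: $K$ is an algebraically closed field; $n,d$ are integers with $2\le d<n$, $\gcd(n,d)=1$, $\mathrm{char}(K)\nmid d$. Put $\ell_0:=[(n+d)/d]$ (integer part) and $m_0:=d\ell_0$. For a degree $n$ polynomial $f(x)\in K[x]$ without repeated roots, $\mathcal C_{f,d}$ is the smooth projective model of the smooth plane affine curve $y^d=f(x)$, and $\mathcal O$ is its unique point at infinity. The curve $\mathcal C_{f,d}$ is identified with its image in its Jacobian under the embedding sending $\mathcal O$ to $0$; a point of $\mathcal C_{f,d}$ has order $m$ if its image in the Jacobian has order $m$. The group $\mu_d$ of $d$-th roots of unity in $K$ acts on $\mathcal C_{f,d}$ by $(x,y)\mapsto(x,\zeta y)$. A packet of torsion points of order $m$ is a nontrivial $\mu_d$-orbit in $\mathcal C_{f,d}(K)$ consisting of points of order $m$ (each packet consists of $d$ distinct points). *)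

(* Defs.v *)
From HB Require Import structures.
From mathcomp Require Import all_boot all_order all_algebra all_field.
From mathcomp Require Import boolp classical_sets.
From mathcomp Require Import freeg.

Set Implicit Arguments.
Unset Strict Implicit.
Unset Printing Implicit Defensive.

Import Order.TTheory GRing.Theory Num.Theory.

Local Open Scope ring_scope.
Local Open Scope quotient_scope.
Local Open Scope classical_set_scope.

(* The smooth projective model of y^d = f(x) is the abstract nonsingular curve
   of its function field K(x)[Y]/(Y^d - f(x)).  As K is algebraically closed,
   the points of this model over K are the normalized discrete valuations of
   the function field that are trivial on K. *)

Local Notation "p %:F" := (FracField.tofrac p).

Section Equation.
Variables (K : fieldType) (d : nat) (f : {poly K}).

(* Y^d - f(x), as a polynomial in Y over K(x). *)
Definition superelliptic_poly : {poly {fraction {poly K}}} :=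
  'X^d - (f%:F)%:P.

Lemma superelliptic_poly_monic : (0 < d)%N -> superelliptic_poly \is monic.
Proof. exact: monicXnsubC. Qed.

Lemma fraction_expr_eq_size n (c : {fraction {poly K}}) e :
  size f = n.+1 -> c ^+ d = (f%:F) ^+ e -> (d %| n * e)%N.
Proof.
move=> szf.
have f0 : f != 0 by rewrite -size_poly_eq0 szf.
have [a [b [b0 cb]]] : exists a b : {poly K}, b != 0 /\ c * b%:F = a%:F.
  elim/quotW: c => r; exists (frac r).1, (frac r).2.
  have r0 : (frac r).2 != 0 by exact: denom_ratioP.
  split=> //; unlock FracField.tofrac; rewrite -[LHS]FracField.pi_mul.
  apply/eqP; rewrite piE /= /FracField.equivf /FracField.mulf /=.
  by rewrite !numden_Ratio ?mulr1 ?oner_neq0 // mulrC.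
move=> cde; have : (f ^+ e * b ^+ d)%:F == (a ^+ d)%:F.
  by rewrite !(rmorphM, rmorphXn) /= -cde -cb exprMn.
rewrite tofrac_eq => /eqP /(congr1 (fun p : {poly K} => (size p).-1)).
rewrite size_mul ?expf_neq0 // size_exp.
have := size_exp f e; have := size_exp b d; rewrite szf /=.
have : (0 < size (f ^+ e))%N by rewrite lt0n size_poly_eq0 expf_neq0.
have : (0 < size (b ^+ d))%N by rewrite lt0n size_poly_eq0 expf_neq0.
case: (size (f ^+ e)) (size (b ^+ d)) => [|s] [|t] // _ _ /= -> ->.
rewrite addnS /= => E; have /dvdn_addl <- : (d %| (size b).-1 * d)%N.
  exact: dvdn_mull.
by rewrite E dvdn_mull.
Qed.

(* The degree of a factor g is a multiple of d: comparing determinants in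
   M^d = f, for M the companion matrix of g, gives a d-th root in K(x) of the
   (deg g)-th power of f. *)
Lemma superelliptic_poly_irreducible n :
    (0 < d)%N -> size f = n.+1 -> coprime n d ->
  monic_irreducible_poly superelliptic_poly.
Proof.
move=> d_gt0 szf co_nd; have pM := superelliptic_poly_monic d_gt0.
have szp : size superelliptic_poly = d.+1 by rewrite size_XnsubC.
split=> //; split=> [|q szq q_dvd]; first by rewrite szp ltnS.
have p0 := monic_neq0 pM.
have q0 : q != 0 by apply: contraTneq q_dvd => ->; rewrite dvd0p.
have lq0 : lead_coef q != 0 by rewrite lead_coef_eq0.
pose g := (lead_coef q)^-1 *: q.
have gq : g %= q by rewrite eqp_scale ?invr_eq0.
have gM : g \is monic by rewrite monicE lead_coefZ mulVf.
have szg : size g = size q by rewrite size_scale ?invr_eq0.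
suff : size q == size superelliptic_poly.
  by rewrite -(dvdp_size_eqp q_dvd).
rewrite szp.
have szq0 : (0 < size q)%N by rewrite lt0n size_poly_eq0.
have [k szk] : exists k, size q = k.+2.
  by case: (size q) szq szq0 => [|[|k]] // _ _; exists k.
have [A AE] : exists A : 'M[{fraction {poly K}}]_k.+1, char_poly A = g.
  have : exists A : 'M[{fraction {poly K}}]_((size g).-1), char_poly A = g.
    by exists (companionmx g); rewrite companionmxK.
  by rewrite szg szk.
have g_dvd : g %| superelliptic_poly by rewrite (eqp_dvdl _ gq).
have A0 : horner_mx A superelliptic_poly = 0.
  by rewrite -(divpK g_dvd) rmorphM /= -AE Cayley_Hamilton mulr0.
have AdE : A ^+ d = (f%:F)%:M.
  move/eqP: A0; rewrite rmorphB rmorphXn /= horner_mx_X horner_mx_C subr_eq0.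
  by move/eqP.
have detX m : \det (A ^+ m) = (\det A) ^+ m.
  elim: m => [|m IHm]; first by rewrite !expr0 det1.
  by rewrite !exprS det_mulmx IHm.
have /(fraction_expr_eq_size szf) : (\det A) ^+ d = (f%:F) ^+ k.+1.
  by rewrite -detX AdE det_scalar.
rewrite Gauss_dvdr 1?coprime_sym // => /dvdn_leq -/(_ isT) dk.
by have := dvdp_leq p0 q_dvd; rewrite szk szp eqn_leq !ltnS dk andbT.
Qed.

End Equation.

Section Curve.
Variables (K : closedFieldType) (d : nat) (f : {poly K}).
Variable irr : monic_irreducible_poly (superelliptic_poly d f).

Definition function_field : fieldType := {poly %/ superelliptic_poly d f with irr}.

Local Notation L := function_field.

Definition ratfun (c : {fraction {poly K}}) : L := qpolyC (superelliptic_poly d f) c.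
Definition coord_x : L := ratfun 'X%:F.
Definition coord_y : L := in_qpoly (superelliptic_poly d f) 'X.

(* Valuations take values in int; the value at 0, normally +oo, is set to 0 so
   that distinct points are distinct functions. *)
Record discrete_valuation (v : L -> int) : Prop := DiscreteValuation {
  valuation0 : v 0 = 0;
  valuationM : forall g h, g != 0 -> h != 0 -> v (g * h) = v g + v h;
  valuationD : forall g h, g != 0 -> h != 0 -> g + h != 0 ->
    Num.min (v g) (v h) <= v (g + h);
  valuationC : forall c : K, c != 0 -> v (ratfun (c%:P)%:F) = 0;
  valuation_uniformizer : exists2 t, t != 0 & v t = 1
}.

Record curve_point := CurvePoint {
  ord_at :> L -> int;
  ord_atP : discrete_valuation ord_at
}.

HB.instance Definition _ := gen_eqMixin curve_point.
HB.instance Definition _ := gen_choiceMixin curve_point.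

(* Exactly one point satisfies this: d and deg f are coprime, so the place at
   infinity of K(x) is totally ramified. *)
Definition at_infinity (P : curve_point) : Prop := P coord_x < 0.

Definition degree0_pred := fun D : {freeg curve_point} => deg D == 0.
Arguments degree0_pred _ /.
Definition degree0 := [qualify a D | degree0_pred D].

Fact degree0_zmod_closed : zmod_closed degree0.
Proof.
split=> [|D E]; first by rewrite qualifE /= deg0.
by rewrite !qualifE /= degB => /eqP -> /eqP ->; rewrite subrr.
Qed.
HB.instance Definition _ :=
  GRing.isZmodClosed.Build {freeg curve_point} degree0_pred degree0_zmod_closed.

Record divisor0 := Divisor0 {
  divisor :> {freeg curve_point};
  _ : divisor \is a degree0
}.
HB.instance Definition _ := [isSub for divisor].
HB.instance Definition _ := [Choice of divisor0 by <:].
HB.instance Definition _ := [SubChoice_isSubZmodule of divisor0 by <:].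

Definition principal : {pred divisor0} := fun D =>
  `[< exists2 h : L, h != 0 & forall P, coeff P (divisor D) = P h >].

Fact principal_zmod_closed : zmod_closed principal.
Proof.
have ord1 (P : curve_point) : P 1 = 0.
  have := valuationM (ord_atP P) (oner_neq0 L) (oner_neq0 L).
  by rewrite mulr1 -[LHS]addr0 => /addrI.
split=> [|D E].
  apply/asboolP; exists 1; rewrite ?oner_neq0 // => P.
  by rewrite coeff0 ord1.
rewrite !unfold_in => /asboolP[g g0 gD] /asboolP[h h0 hE].
apply/asboolP; exists (g / h) => [|P]; first by rewrite mulf_neq0 ?invr_eq0.
have hV0 : h^-1 != 0 by rewrite invr_eq0.
rewrite (raddfB val D E : divisor (D - E) = _) coeffB gD hE (valuationM (ord_atP P)) //; congr (_ + _).
apply/eqP; rewrite eq_sym -addr_eq0 -(valuationM (ord_atP P)) //.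
by rewrite mulVf // ord1.
Qed.
HB.instance Definition _ :=
  GRing.isZmodClosed.Build divisor0 principal principal_zmod_closed.

(* K-points of the Jacobian: degree 0 divisors modulo principal ones. *)
Definition jacobian := Quotient.quot principal.

Fact point_sub_degree0 (P O : curve_point) : <<P>> - <<O>> \is a degree0.
Proof. by rewrite qualifE /= degB !degU subrr. Qed.

Definition jacobian_embedding (O P : curve_point) : jacobian :=
  \pi_jacobian (Divisor0 (point_sub_degree0 P O)).

Definition has_order (V : zmodType) (g : V) (m : nat) : Prop :=
  [/\ (0 < m)%N, g *+ m = 0 & forall k, (0 < k < m)%N -> g *+ k <> 0].

(* Pullback of functions along (x, y) |-> (x, z y). *)
Definition mu_pullback (z : K) (h : L) : L :=
  in_qpoly (superelliptic_poly d f) ((h : {poly _}) \Po ((z%:P)%:F *: 'X)).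

(* The point z.P is the one with ord_{z.P}(h) = ord_P(h o z). *)
Definition mu_orbit (P : curve_point) : set curve_point :=
  [set Q | exists2 z : K, z ^+ d = 1 & forall h, Q h = P (mu_pullback z h)].

Definition torsion_packet (O : curve_point) (m : nat) (A : set curve_point) : Prop :=
  [/\ exists P, A = mu_orbit P,
      exists P Q, [/\ A P, A Q & P <> Q] &
      forall P, A P -> has_order (jacobian_embedding O P) m].

End Curve.

(* Main.v *)
(* A point P of order m0 = d l0 gives a function with divisor m0 P - m0 O.
   It has no pole outside O, so it lies in K[x, y], and comparing pole orders at
   O shows that it is proportional to v(x) - y with deg v = l0. Its norm
   v^d - f vanishes only at the abscissa a of P, so f = v^d + alpha (x - a)^m0.
   Two packets give two such equations, with a <> b: equal abscissas would put
   the points in one mu_d-orbit. For p = x - a and q = x - b the operator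
     g |-> m0 (m0 - 1) g - (m0 - 1) (p + q) g' + p q g''
   kills p^m0 and q^m0 and maps w^d to a multiple of w^(d-2), while it preserves
   the degree n of f because m0 is neither n nor n + 1. As v1 and v2 are coprime,
   (v1 v2)^(d-2) divides the image of f, so 2 (d - 2) l0 <= n < d l0 and d < 4.
   Finally d = 2 would force m0 = n + 1, so d = 3, n = 1 mod 3 and n + 2 = m0.

   That the function lies in K[x, y] requires a point above every b in K; it is
   the discrete valuation obtained by writing functions near (b, e), e^d = f(b),
   as powers of a uniformizer times quotients of polynomials not vanishing at
   (b, e). *)

From HB Require Import structures.
Require Import Defs.
From mathcomp Require Import all_boot all_order all_algebra all_field cyclic.
From mathcomp Require Import boolp classical_sets.
From mathcomp Require Import freeg ring zify.

Set Implicit Arguments.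
Unset Strict Implicit.
Unset Printing Implicit Defensive.

Import Order.TTheory GRing.Theory Num.Theory.
Import Pdiv.CommonRing Pdiv.RingMonic.

Local Open Scope ring_scope.

Local Notation "p %:F" := (FracField.tofrac p).

(** * Two representations as a d-th power plus a power of a linear form *)

Section Wronskian.
Variables (K : fieldType) (m : nat) (p q : {poly K}).
Hypotheses (dp : p^`() = 1) (dq : q^`() = 1).

(* The equation solved by [p ^+ m.+2] and [q ^+ m.+2]: up to a factor, this is
   their Wronskian with [g]. *)
Definition wronsk (g : {poly K}) : {poly K} :=
  (m.+2 * m.+1)%:R * g - m.+1%:R * (p + q) * g^`() + p * q * g^`()^`().

Lemma wronskD g h : wronsk (g + h) = wronsk g + wronsk h.
Proof.
rewrite /wronsk !derivD.
by move: ((m.+2 * m.+1)%:R : {poly K}) (m.+1%:R : {poly K}) => *; ring.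
Qed.

Lemma wronskZ c g : wronsk (c *: g) = c *: wronsk g.
Proof.
rewrite /wronsk !derivZ -!mul_polyC.
by move: ((m.+2 * m.+1)%:R : {poly K}) (m.+1%:R : {poly K}) => *; ring.
Qed.

Lemma wronsk_left : wronsk (p ^+ m.+2) = 0.
Proof.
rewrite /wronsk deriv_exp dp mul1r derivMn deriv_exp dp mul1r /=.
rewrite -[p ^+ m.+1 *+ _]mulr_natl -[p ^+ m *+ _ *+ _]mulr_natl -[p ^+ m *+ _]mulr_natl.
rewrite !exprS natrM.
by move: (m.+2%:R : {poly K}) (m.+1%:R : {poly K}) (p ^+ m) => *; ring.
Qed.

Lemma wronsk_right : wronsk (q ^+ m.+2) = 0.
Proof.
rewrite /wronsk deriv_exp dq mul1r derivMn deriv_exp dq mul1r /=.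
rewrite -[q ^+ m.+1 *+ _]mulr_natl -[q ^+ m *+ _ *+ _]mulr_natl -[q ^+ m *+ _]mulr_natl.
rewrite !exprS natrM.
by move: (m.+2%:R : {poly K}) (m.+1%:R : {poly K}) (q ^+ m) => *; ring.
Qed.

Lemma dvdp_wronsk_exp e (v : {poly K}) : v ^+ e %| wronsk (v ^+ e.+2).
Proof.
rewrite /wronsk deriv_exp /= derivMn derivM deriv_exp /=.
rewrite -[(_ + _) *+ _]mulr_natl -[v^`() * v ^+ e *+ _]mulr_natl.
rewrite -[v^`() * v ^+ e.+1 *+ _]mulr_natl.
rewrite !exprS.
move: (v ^+ e) (e.+2%:R : {poly K}) (e.+1%:R : {poly K}) (m.+1%:R : {poly K}).
move: ((m.+2 * m.+1)%:R : {poly K}) (v^`()) (v^`()^`()) => M v1 v2 w e2 e1 m1.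
rewrite (_ : _ + _ = (M * (v * v) - m1 * (p + q) * (e2 * (v * v1))
   + p * q * (e2 * (v * v2 + e1 * v1 * v1))) * w); first exact: dvdp_mulIr.
by ring.
Qed.

Lemma size_wronsk (g : {poly K}) n : size p = 2%N -> size q = 2%N ->
  size g = n.+3 -> (size (wronsk g) <= n.+3)%N.
Proof.
move=> sp sq sg.
have s1 : (size g^`() <= n.+2)%N.
  by rewrite -ltnS -sg lt_size_deriv // -size_poly_eq0 sg.
have s2 : (size g^`()^`() <= n.+1)%N.
  case: (eqVneq g^`() 0) => [->|g1]; first by rewrite deriv0 size_poly0.
  by rewrite -ltnS (leq_trans _ s1) // lt_size_deriv.
rewrite /wronsk (leq_trans (size_polyD _ _)) // geq_max; apply/andP; split.
  rewrite (leq_trans (size_polyD _ _)) // geq_max size_polyN; apply/andP; split.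
    by rewrite mulr_natl -scaler_nat (leq_trans (size_scale_leq _ _)) ?sg.
  rewrite mulr_natl mulrnAl -scaler_nat (leq_trans (size_scale_leq _ _)) //.
  rewrite (leq_trans (size_polyMleq _ _)) //.
  have : (size (p + q)%R <= 2)%N by rewrite (leq_trans (size_polyD _ _)) // sp sq.
  by move: s1; move: (size _) (size _) => x y; lia.
rewrite (leq_trans (size_polyMleq _ _)) //.
have : (size (p * q)%R <= 3)%N by rewrite (leq_trans (size_polyMleq _ _)) // sp sq.
by move: s2; move: (size _) (size _) => x y; lia.
Qed.

End Wronskian.

Section TwoPowers.
Variables (K : fieldType) (a b : K).
Hypothesis charK : [pchar K] =i pred0.
Local Notation p := ('X - a%:P).
Local Notation q := ('X - b%:P).

Lemma coef_wronsk m n (g : {poly K}) : size g = n.+3 ->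
  (wronsk m p q g)`_n.+2 =
  ((m%:R - n%:R) * (m%:R - n%:R - 1)) * g`_n.+2.
Proof.
move=> sg; have g3 : g`_n.+3 = 0 by rewrite nth_default ?sg.
have g4 : g`_n.+4 = 0 by rewrite nth_default ?sg.
rewrite /wronsk.
have -> : (m.+2 * m.+1)%:R * g - m.+1%:R * (p + q) * g^`() + p * q * g^`()^`() =
  g *+ (m.+2 * m.+1) - (g^`() * 'X *+ 2 - (a + b) *: g^`()) *+ m.+1
   + (g^`()^`() * 'X * 'X - (a + b) *: (g^`()^`() * 'X)
   + (a * b) *: g^`()^`()).
  rewrite -[g *+ _]mulr_natl -[(_ - _) *+ _]mulr_natl -!mul_polyC polyCM polyCD.
  move: ((m.+2 * m.+1)%:R : {poly K}) (m.+1%:R : {poly K}) (a%:P) (b%:P) => *.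
  by ring.
rewrite !(coefD, coefN, coefMn, coefMX, coefZ, coef_deriv) /= g3 g4.
by move: (g`_n.+1) (g`_n.+2) => *; ring.
Qed.

(* If [f] is in two ways a [d]-th power plus a multiple of the [m]-th power of
   a linear form, then its image under [wronsk] is divisible by the [d-2]-nd
   powers of both bases, and has the same degree as [f]. *)
Lemma two_powers_degree (f v1 v2 : {poly K}) (alpha beta : K) d l n :
  a != b -> (1 < d)%N -> (1 < n)%N -> (n < d * l)%N -> (d * l)%N <> n.+1 ->
  size f = n.+1 -> size v1 = l.+1 -> size v2 = l.+1 ->
  f = v1 ^+ d + alpha *: p ^+ (d * l) -> f = v2 ^+ d + beta *: q ^+ (d * l) ->
  (2 * (d - 2) * l <= n)%N.
Proof.
move=> ab d1 n1 ndl dln sf s1 s2 f1 f2.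
have [e de] : exists e, d = e.+2 by exists (d - 2)%N; lia.
have [k nk] : exists k, n = k.+2 by exists (n - 2)%N; lia.
have [m mE] : exists m, (d * l)%N = m.+2 by exists (d * l - 2)%N; lia.
have nz r : (r.+1%:R : K) != 0.
  by rewrite ((pcharf0P K).1 charK).
have v10 : v1 != 0 by rewrite -size_poly_eq0 s1.
have v20 : v2 != 0 by rewrite -size_poly_eq0 s2.
have alpha0 : alpha != 0.
  apply: contraTneq ndl => a0; rewrite -leqNgt.
  have : size (v1 ^+ d) = (d * l).+1.
    by rewrite (polySpred (expf_neq0 d v10)) size_exp s1 mulnC.
  by rewrite -[v1 ^+ d]addr0 -(scale0r (p ^+ (d * l))) -a0 -f1 sf => -[->].
have beta0 : beta != 0.
  apply: contraTneq ndl => a0; rewrite -leqNgt.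
  have : size (v2 ^+ d) = (d * l).+1.
    by rewrite (polySpred (expf_neq0 d v20)) size_exp s2 mulnC.
  by rewrite -[v2 ^+ d]addr0 -(scale0r (q ^+ (d * l))) -a0 -f2 sf => -[->].
have co12 : coprimep (v1 ^+ e) (v2 ^+ e).
  apply: coprimep_expl; apply: coprimep_expr; apply/coprimepP => r r1 r2.
  have d1v : v2 ^+ d - v1 ^+ d = alpha *: p ^+ m.+2 - beta *: q ^+ m.+2.
    rewrite -mE -[v1 ^+ d](addrK (alpha *: p ^+ (d * l))) -f1 f2.
    by move: (v2 ^+ d) (alpha *: _) (beta *: _) => *; ring.
  have d2v : v2^`() * v2 ^+ e.+1 *+ d - v1^`() * v1 ^+ e.+1 *+ d =
             (alpha *: p ^+ m.+1 - beta *: q ^+ m.+1) *+ m.+2.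
    have /(congr1 (@deriv K)) := d1v.
    rewrite !derivB !derivZ !deriv_exp !derivXsubC !mul1r de /= => ->.
    by rewrite -!scalerMnr -mulrnBl.
  have rT : r %| alpha *: p ^+ m.+2 - beta *: q ^+ m.+2.
    by rewrite -d1v de !exprS; apply: dvdp_sub; apply: dvdp_mulr.
  have rT' : r %| alpha *: p ^+ m.+1 - beta *: q ^+ m.+1.
    rewrite -(dvdpZr _ _ (nz m.+1)) scaler_nat -d2v !exprS.
    by apply: dvdp_sub; rewrite -mulr_natl;
       apply: dvdp_mull; apply: dvdp_mull; apply: dvdp_mulr.
  have rq : r %| q ^+ m.+1.
    have ba : beta * (b - a) != 0 by rewrite mulf_neq0 // subr_eq0 eq_sym.
    rewrite -(dvdpZr _ _ ba).
    have -> : (beta * (b - a)) *: q ^+ m.+1 = (alpha *: p ^+ m.+2 - beta *: q ^+ m.+2)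
       - p * (alpha *: p ^+ m.+1 - beta *: q ^+ m.+1).
      by rewrite !exprS -!mul_polyC !polyCM polyCB; move: (p ^+ m) (q ^+ m) => *; ring.
    by apply: dvdp_sub => //; apply: dvdp_mull.
  have rp : r %| p ^+ m.+1.
    have ba : alpha * (b - a) != 0 by rewrite mulf_neq0 // subr_eq0 eq_sym.
    rewrite -(dvdpZr _ _ ba).
    have -> : (alpha * (b - a)) *: p ^+ m.+1 = (alpha *: p ^+ m.+2 - beta *: q ^+ m.+2)
       - q * (alpha *: p ^+ m.+1 - beta *: q ^+ m.+1).
      by rewrite !exprS -!mul_polyC !polyCM polyCB; move: (p ^+ m) (q ^+ m) => *; ring.
    by apply: dvdp_sub => //; apply: dvdp_mull.
  have /coprimepP : coprimep (p ^+ m.+1) (q ^+ m.+1).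
    apply: coprimep_expl; apply: coprimep_expr; apply: coprimep_XsubC2.
    by rewrite subr_eq0 eq_sym.
  by apply.
have sp : size p = 2%N by rewrite size_XsubC.
have sq : size q = 2%N by rewrite size_XsubC.
set G := wronsk m p q f.
have G1 : G = wronsk m p q (v1 ^+ d).
  by rewrite /G f1 wronskD wronskZ mE wronsk_left ?derivXsubC // scaler0 addr0.
have G2 : G = wronsk m p q (v2 ^+ d).
  by rewrite /G f2 wronskD wronskZ mE wronsk_right ?derivXsubC // scaler0 addr0.
have dG : v1 ^+ e * v2 ^+ e %| G.
  rewrite Gauss_dvdp // {1}G1 G2 de !dvdp_wronsk_exp //.
have G0 : G != 0.
  have fk : f`_k.+2 != 0.
    by rewrite -[k.+2]/(k.+3.-1) -nk -sf -lead_coefE lead_coef_eq0 -size_poly_eq0 sf.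
  have [j jE] : exists j, m = (j.+2 + k)%N by exists (m - k - 2)%N; lia.
  apply/eqP => G0; have := @coef_wronsk m k f.
  rewrite sf nk -/G G0 coef0 => /(_ erefl) /esym /eqP.
  rewrite !mulf_eq0 (negPf fk) orbF jE natrD addrK (negPf (nz _)) /=.
  by rewrite -natr1 addrK (negPf (nz _)).
have := dvdp_leq G0 dG; rewrite size_mul ?expf_neq0 // => le1.
have := leq_trans le1 (size_wronsk m sp sq (etrans sf (congr1 S nk))).
rewrite (polySpred (expf_neq0 e v10)) (polySpred (expf_neq0 e v20)) !size_exp s1 s2.
by rewrite de nk; lia.
Qed.
End TwoPowers.

(** * Valuations *)

Definition valuation (L : fieldType) (v : L -> int) : Prop :=
  [/\ v 0 = 0, forall g h, g != 0 -> h != 0 -> v (g * h) = v g + v h &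
    forall g h, g != 0 -> h != 0 -> g + h != 0 ->
      Num.min (v g) (v h) <= v (g + h)].

(* [vge v k g] says that the valuation of [g] is at least [k]; it holds for
   [g = 0], where [v] takes the junk value [0]. *)
Definition vge (L : fieldType) (v : L -> int) (k : int) (g : L) : bool :=
  (g == 0) || (k <= v g).

Section Valuation.
Variables (L : fieldType) (v : L -> int).
Hypothesis vP : valuation v.
Implicit Types (g h : L) (k l : int).

Lemma valg0 : v 0 = 0. Proof. by case: vP. Qed.

Lemma valgM g h : g != 0 -> h != 0 -> v (g * h) = v g + v h.
Proof. by case: vP => _ + _; apply. Qed.

Lemma valgD g h : g != 0 -> h != 0 -> g + h != 0 ->
  Num.min (v g) (v h) <= v (g + h).
Proof. by case: vP => _ _; apply. Qed.

Lemma valg1 : v 1 = 0.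
Proof.
by have := valgM (oner_neq0 L) (oner_neq0 L); rewrite mulr1 -[LHS]addr0 => /addrI.
Qed.

Lemma valgN g : v (- g) = v g.
Proof.
have [->|g0] := eqVneq g 0; first by rewrite oppr0.
have n1 : (-1 : L) != 0 by rewrite oppr_eq0 oner_neq0.
have : v (-1) + v (-1) = 0 by rewrite -valgM // mulrNN mulr1 valg1.
by rewrite -(mulN1r g) (valgM n1 g0); move: (v (-1)) (v g) => x y e; lia.
Qed.

Lemma valgX g n : g != 0 -> v (g ^+ n) = v g *+ n.
Proof.
move=> g0; elim: n => [|n IHn]; first by rewrite expr0 valg1 mulr0n.
by rewrite exprS valgM ?expf_neq0 // IHn mulrS.
Qed.

Lemma vgeE k g : g != 0 -> vge v k g = (k <= v g).
Proof. by rewrite /vge => /negPf ->. Qed.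

Lemma vge0 k : vge v k 0.
Proof. by rewrite /vge eqxx. Qed.

Lemma vge_le k l g : k <= l -> vge v l g -> vge v k g.
Proof.
by rewrite /vge => kl /orP[->//|lg]; rewrite (le_trans kl lg) orbT.
Qed.

Lemma vge0P g : 0 <= v g -> vge v 0 g.
Proof. by rewrite /vge => ->; rewrite orbT. Qed.

Lemma vgeD k g h : vge v k g -> vge v k h -> vge v k (g + h).
Proof.
have [->|g0] := eqVneq g 0; first by rewrite add0r.
have [->|h0] := eqVneq h 0; first by rewrite addr0.
have [->|gh0] := eqVneq (g + h) 0; first by rewrite vge0.
rewrite !vgeE // => kg kh; apply: le_trans (valgD g0 h0 gh0).
by rewrite le_min kg.
Qed.

Lemma vgeN k g : vge v k (- g) = vge v k g.
Proof. by rewrite /vge oppr_eq0 valgN. Qed.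

Lemma vgeB k g h : vge v k g -> vge v k h -> vge v k (g - h).
Proof. by move=> kg kh; apply: vgeD; rewrite ?vgeN. Qed.

Lemma vge_sum k (I : Type) (r : seq I) (P : pred I) (F : I -> L) :
  (forall i, P i -> vge v k (F i)) -> vge v k (\sum_(i <- r | P i) F i).
Proof.
move=> kF; elim/big_rec: _ => [|i x Pi kx]; first exact: vge0.
by apply: vgeD => //; apply: kF.
Qed.

Lemma vgeM k l g h : vge v k g -> vge v l h -> vge v (k + l) (g * h).
Proof.
have [->|g0] := eqVneq g 0; first by rewrite mul0r !vge0.
have [->|h0] := eqVneq h 0; first by rewrite mulr0 !vge0.
by rewrite !vgeE ?mulf_neq0 // valgM //; exact: lerD.
Qed.

Lemma valgD_dominant g h : g != 0 -> vge v (v g + 1) h ->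
  g + h != 0 /\ v (g + h) = v g.
Proof.
move=> g0 gh; have [E|gh0] := eqVneq (g + h) 0.
  move: gh; have -> : h = - g by apply/eqP; rewrite -addr_eq0 addrC E.
  by rewrite vgeN vgeE //; lia.
split=> //; apply/eqP; rewrite eq_le; apply/andP; split.
  rewrite leNgt; apply/negP => lt.
  have : vge v (v g + 1) (g + h - h).
    by apply: vgeB => //; rewrite vgeE //; lia.
  by rewrite addrK vgeE //; lia.
have : vge v (v g) (g + h).
  by apply: vgeD; [rewrite vgeE | apply: (vge_le _ gh); lia].
by rewrite vgeE.
Qed.

Lemma val_sum_distinct n (t : 'I_n -> L) :
    (forall i j, t i != 0 -> t j != 0 -> v (t i) = v (t j) -> i = j) ->
    (exists i, t i != 0) ->
  exists i, [/\ t i != 0, \sum_j t j != 0, v (\sum_j t j) = v (t i) &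
    forall j, t j != 0 -> v (t i) <= v (t j)].
Proof.
move=> inj [i0 ti0].
case: (@Order.TotalTheory.arg_minP _ _ _ i0 (fun i => t i != 0)
         (fun i => v (t i)) ti0) => i ti min_i.
exists i; have [||ne eqv] := @valgD_dominant (t i) (\sum_(j | j != i) t j) => //.
  apply: vge_sum => j ji; have [->|tj] := eqVneq (t j) 0; first exact: vge0.
  rewrite vgeE //; have := min_i _ tj; rewrite le_eqVlt => /orP[/eqP /inj E|].
    by move: ji; rewrite E ?eqxx.
  by lia.
by rewrite (bigD1 i).
Qed.

End Valuation.

Section PolynomialValuation.
Variables (K L : fieldType) (v : L -> int) (c : {rmorphism {poly K} -> L}).
Hypotheses (vP : valuation v) (vC : forall a : K, a != 0 -> v (c a%:P) = 0).
Hypothesis c_inj : forall p, (c p == 0) = (p == 0).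

Lemma vge_const (a : K) : vge v 0 (c a%:P).
Proof.
have [->|a0] := eqVneq a 0; first by rewrite rmorph0 vge0.
by rewrite vgeE ?c_inj ?polyC_eq0 // vC.
Qed.

Lemma val_poly_infinity p : v (c 'X) < 0 -> p != 0 ->
  v (c p) = v (c 'X) *+ (size p).-1.
Proof.
move=> X_lt0; elim/poly_ind: p => [|p a IHp]; first by rewrite eqxx.
have [->|p0 pXa] := eqVneq p 0.
  rewrite mul0r add0r polyC_eq0 => a0.
  by rewrite vC // size_polyC a0 mulr0n.
have X0 : c 'X != 0 by rewrite c_inj polyX_eq0.
have cp0 : c p != 0 by rewrite c_inj.
have vpX : v (c (p * 'X)) = v (c 'X) *+ size p.
  by rewrite rmorphM valgM // IHp // addrC -mulrS -polySpred.
rewrite rmorphD size_MXaddC (negPf p0) /= -vpX.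
apply: (@valgD_dominant _ _ vP _ _ _ _).2; first by rewrite rmorphM mulf_neq0.
apply: (@vge_le _ _ _ 0); last exact: vge_const.
have := polySpred p0; case: (size p) vpX => // s -> _.
by rewrite -mulr_natr mulrS; nia.
Qed.

Variable b : K.
Hypothesis v_gt0 : 0 < v (c ('X - b%:P)).

Lemma vge_poly p : vge v 0 (c p).
Proof.
have vX : vge v 0 (c 'X).
  rewrite -['X](subrK b%:P) rmorphD; apply: vgeD (vge_const b) => //.
  by apply: vge0P; exact: ltW.
elim/poly_ind: p => [|p a IHp]; first by rewrite rmorph0 vge0.
by rewrite rmorphD rmorphM; apply: vgeD (vge_const a) => //; exact: (@vgeM _ _ vP 0 0).
Qed.

Lemma val_poly_nonroot p : p.[b] != 0 -> v (c p) = 0.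
Proof.
move=> pb; have [q pE] : exists q, p - p.[b]%:P = q * ('X - b%:P).
  by apply/factor_theorem; rewrite rootE !hornerE subrr.
have cb : c p.[b]%:P != 0 by rewrite c_inj polyC_eq0.
have -> : p = p.[b]%:P + q * ('X - b%:P) by rewrite -pE addrC subrK.
rewrite rmorphD -[RHS](vC pb); apply: (@valgD_dominant _ _ vP _ _ _ _).2 => //.
rewrite vC // rmorphM; apply: (vgeM vP (vge_poly q)).
by rewrite vgeE ?c_inj ?polyXsubC_eq0 //; lia.
Qed.

Lemma val_poly_root p : p.[b] = 0 -> vge v (v (c ('X - b%:P))) (c p).
Proof.
move=> pb; have /factor_theorem[q ->] : root p b by rewrite rootE pb.
rewrite rmorphM -[X in vge _ X]add0r; apply: (vgeM vP (vge_poly q)).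
by rewrite vgeE ?c_inj ?polyXsubC_eq0.
Qed.

Lemma val_poly_simple p : p != 0 -> (mup b p <= 1)%N -> v (c p) <= v (c ('X - b%:P)).
Proof.
move=> p0; have [pb|pb _] := eqVneq p.[b] 0; last first.
  by rewrite val_poly_nonroot // ltW.
have /factor_theorem[q pE] : root p b by rewrite rootE pb.
have q0 : q != 0 by apply: contraNneq p0 => q0; rewrite pE q0 mul0r.
rewrite pE mupM ?polyXsubC_eq0 // (mup_XsubCX 1) eqxx addn1 ltnS leqn0.
move=> /eqP mq; rewrite rmorphM valgM ?c_inj ?polyXsubC_eq0 // val_poly_nonroot ?add0r //.
apply/negP => qb; have := XsubC_dvd b q0.
by rewrite dvdp_XsubCl rootE qb mq.
Qed.

End PolynomialValuation.

(** * The function field and its points *)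

Lemma fraction_repr (R : idomainType) (c : {fraction R}) :
  exists a b : R, b != 0 /\ c * b%:F = a%:F.
Proof.
elim/quotW: c => r; exists (frac r).1, (frac r).2.
have r0 : (frac r).2 != 0 by exact: denom_ratioP.
split=> //; unlock FracField.tofrac; rewrite -[LHS]FracField.pi_mul.
apply/eqP; rewrite piE /= /FracField.equivf /FracField.mulf /=.
by rewrite !numden_Ratio ?mulr1 ?oner_neq0 // mulrC.
Qed.

Lemma poly_fraction_repr (R : idomainType) (g : {poly {fraction R}}) :
  exists (G : {poly R}) (b : R), b != 0 /\ b%:F *: g = map_poly (@FracField.tofrac R) G.
Proof.
elim/poly_ind: g => [|g c [G [b [b0 bg]]]].
  by exists 0, 1; rewrite oner_neq0 scaler0 rmorph0.
have [a [e [e0 ce]]] := fraction_repr c.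
exists ((e *: G) * 'X + (b * a)%:P), (b * e); split; first by rewrite mulf_neq0.
rewrite [RHS]rmorphD /= [map_poly _ (_ * 'X)]rmorphM /= map_polyX map_polyC map_polyZ /=.
rewrite -bg scalerDr !tofracM -ce scalerA -scalerAl [e%:F * _]mulrC; congr (_ + _).
by rewrite -mul_polyC -polyCM -mulrA [e%:F * _]mulrC.
Qed.

Section Curve.
Variables (K : closedFieldType) (d : nat) (f : {poly K}).
Variable irr : monic_irreducible_poly (superelliptic_poly d f).
Local Notation L := (function_field irr).
Local Notation phi := (superelliptic_poly d f).
Local Notation y := (coord_y irr).
Hypothesis d_gt1 : (1 < d)%N.

Definition poly_fun (p : {poly K}) : L := ratfun irr p%:F.

(* The outer variable of [G] is y, the inner one is x. *)
Definition bipoly_fun (G : {poly {poly K}}) : L :=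
  in_qpoly phi (map_poly (@FracField.tofrac {poly K}) G).

Fact poly_fun_is_zmod_morphism : zmod_morphism poly_fun.
Proof. by move=> p q; rewrite /poly_fun rmorphB; exact: (rmorphB (qpolyC phi)). Qed.

Fact poly_fun_is_monoid_morphism : monoid_morphism poly_fun.
Proof.
split=> [|p q]; rewrite /poly_fun ?rmorph1 ?rmorphM; first exact: (rmorph1 (qpolyC phi)).
exact: (rmorphM (qpolyC phi)).
Qed.

HB.instance Definition _ :=
  GRing.isZmodMorphism.Build {poly K} L poly_fun poly_fun_is_zmod_morphism.
HB.instance Definition _ :=
  GRing.isMonoidMorphism.Build {poly K} L poly_fun poly_fun_is_monoid_morphism.

Fact bipoly_fun_is_zmod_morphism : zmod_morphism bipoly_fun.
Proof. by move=> p q; rewrite /bipoly_fun rmorphB; exact: (rmorphB (in_qpoly phi)). Qed.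

Fact bipoly_fun_is_monoid_morphism : monoid_morphism bipoly_fun.
Proof.
split=> [|p q]; first by rewrite /bipoly_fun (rmorph1 (map_poly _)); exact: in_qpoly1.
by rewrite /bipoly_fun (rmorphM (map_poly _)); exact: in_qpolyM.
Qed.

HB.instance Definition _ :=
  GRing.isZmodMorphism.Build {poly {poly K}} L bipoly_fun bipoly_fun_is_zmod_morphism.
HB.instance Definition _ :=
  GRing.isMonoidMorphism.Build {poly {poly K}} L bipoly_fun
    bipoly_fun_is_monoid_morphism.

Lemma bipoly_funD G H : bipoly_fun (G + H) = bipoly_fun G + bipoly_fun H.
Proof. exact: rmorphD. Qed.

Lemma bipoly_funB G H : bipoly_fun (G - H) = bipoly_fun G - bipoly_fun H.
Proof. exact: rmorphB. Qed.

Lemma bipoly_funM G H : bipoly_fun (G * H) = bipoly_fun G * bipoly_fun H.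
Proof. exact: rmorphM. Qed.

Lemma bipoly_fun_exp G k : bipoly_fun (G ^+ k) = bipoly_fun G ^+ k.
Proof. exact: rmorphXn. Qed.

Lemma bipoly_fun1 : bipoly_fun 1 = 1.
Proof. exact: rmorph1. Qed.

Lemma poly_funB p q : poly_fun (p - q) = poly_fun p - poly_fun q.
Proof. exact: rmorphB. Qed.

Lemma poly_funM p q : poly_fun (p * q) = poly_fun p * poly_fun q.
Proof. exact: rmorphM. Qed.

Lemma poly_fun_exp p k : poly_fun (p ^+ k) = poly_fun p ^+ k.
Proof. exact: rmorphXn. Qed.

Lemma size_phi : size phi = d.+1.
Proof. by rewrite size_XnsubC // ltnW. Qed.

Lemma in_qpolyE (g : {poly {fraction {poly K}}}) :
  in_qpoly phi g = rmodp g phi :> {poly _}.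
Proof. by rewrite /= (mk_monicE irr). Qed.

Lemma in_qpoly_id (h : L) : in_qpoly phi (h : {poly _}) = h.
Proof.
apply/val_inj => /=; rewrite rmodp_small //.
have := size_npoly h; rewrite -ltnS prednK //.
by rewrite lt0n size_poly_eq0 mk_monic_neq0.
Qed.

Lemma poly_funE p : poly_fun p = bipoly_fun p%:P.
Proof.
apply: val_inj; rewrite /bipoly_fun map_polyC /= (mk_monicE irr) rmodp_small //.
by rewrite size_phi size_polyC (leq_ltn_trans (leq_b1 _)) // ltnS ltnW.
Qed.

Lemma bipoly_funX : bipoly_fun 'X = y.
Proof. by rewrite /bipoly_fun map_polyX. Qed.

Lemma poly_fun_eq0 p : (poly_fun p == 0) = (p == 0).
Proof.
apply/eqP/eqP => [/(congr1 val)/eqP|->]; last exact: rmorph0.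
by rewrite /= polyC_eq0 tofrac_eq0 => /eqP.
Qed.

Lemma bipoly_fun_eq0 (G : {poly {poly K}}) :
  (size G <= d)%N -> (bipoly_fun G == 0) = (G == 0).
Proof.
have inj : injective (@FracField.tofrac {poly K}).
  by move=> p q /eqP; rewrite tofrac_eq => /eqP.
move=> sG; have sG' : (size (map_poly (@FracField.tofrac {poly K}) G) < size phi)%N.
  by rewrite size_phi ltnS size_map_inj_poly ?tofrac0.
apply/eqP/eqP => [/(congr1 val)|->]; last exact: rmorph0.
rewrite /= (mk_monicE irr) rmodp_small // -(rmorph0 (map_poly (@FracField.tofrac {poly K}))).
exact: (map_inj_poly inj (tofrac0 _)).
Qed.

Lemma coord_yXd : y ^+ d = poly_fun f.
Proof.
rewrite -bipoly_funX poly_funE -rmorphXn; apply/eqP; rewrite -subr_eq0 -rmorphB.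
rewrite /= /bipoly_fun; 
have -> : map_poly (@FracField.tofrac {poly K}) ('X^d - f%:P) = phi.
  by rewrite rmorphB /= map_polyXn map_polyC.
apply/eqP.
by apply: val_inj; rewrite /= (mk_monicE irr) rmodpp // irr.
Qed.

Lemma bipoly_fun_sum (G : {poly {poly K}}) :
  bipoly_fun G = \sum_(j < size G) poly_fun G`_j * y ^+ j.
Proof.
rewrite -[in LHS](coefK G) poly_def rmorph_sum; apply: eq_bigr => j _.
by rewrite -mul_polyC rmorphM rmorphXn /= bipoly_funX poly_funE.
Qed.

Lemma bipoly_fun_reduce (G : {poly {poly K}}) :
  exists2 H : {poly {poly K}}, (size H <= d)%N & bipoly_fun G = bipoly_fun H /\
    exists Q, G = Q * ('X^d - f%:P) + H.
Proof.
have mP : 'X^d - f%:P \is monic by apply: monicXnsubC; exact: ltnW.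
exists (rmodp G ('X^d - f%:P)).
  by rewrite -ltnS -[X in (_ < X)%N](@size_XnsubC _ _ f) ?ltn_rmodpN0 ?monic_neq0 // ltnW.
have E := rdivp_eq mP G; split; last by exists (rdivp G ('X^d - f%:P)).
rewrite {1}E rmorphD rmorphM rmorphB rmorphXn /= bipoly_funX -poly_funE coord_yXd.
by rewrite subrr mulr0 add0r.
Qed.

Lemma bipoly_fun_ker (G : {poly {poly K}}) :
  bipoly_fun G = 0 -> exists Q, G = Q * ('X^d - f%:P).
Proof.
move=> G0; have [H sH [GH [Q GQ]]] := bipoly_fun_reduce G.
exists Q; rewrite GQ; suff -> : H = 0 by rewrite addr0.
by apply/eqP; rewrite -bipoly_fun_eq0 // -GH G0.
Qed.

Lemma function_repr (h : L) : exists (G : {poly {poly K}}) (p : {poly K}),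
  [/\ (size G <= d)%N, p != 0 & h * poly_fun p = bipoly_fun G].
Proof.
have [G [p [p0 pG]]] := poly_fraction_repr (h : {poly _}).
have [H sH [GH _]] := bipoly_fun_reduce G; exists H, p; split=> //.
rewrite -GH /bipoly_fun -pG -mul_polyC in_qpolyM in_qpoly_id mulrC; congr (_ * _).
by rewrite poly_funE /bipoly_fun map_polyC.
Qed.

End Curve.

Section Points.
Variables (K : closedFieldType) (d : nat) (f : {poly K}).
Variable irr : monic_irreducible_poly (superelliptic_poly d f).
Local Notation L := (function_field irr).
Local Notation phi := (superelliptic_poly d f).
Local Notation y := (coord_y irr).
Local Notation c := (poly_fun irr).
Hypothesis d_gt1 : (1 < d)%N.

Lemma mu_pullback_in_qpoly (z : K) (g : {poly {fraction {poly K}}}) : z ^+ d = 1 ->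
  mu_pullback (irr := irr) z (in_qpoly phi g) = in_qpoly phi (g \Po ((z%:P)%:F *: 'X)).
Proof.
move=> zd; have E := rdivp_eq irr.2 g.
rewrite /mu_pullback [polyn _](in_qpolyE irr) [in RHS]E comp_polyD comp_polyM.
have -> : phi \Po ((z%:P)%:F *: 'X) = phi.
  rewrite /superelliptic_poly comp_polyB comp_polyC comp_Xn_poly exprZn.
  by rewrite -tofracXn -rmorphXn zd !rmorph1 scale1r.
rewrite [RHS]in_qpolyD in_qpolyM; have -> : in_qpoly phi phi = 0.
  by apply: val_inj; rewrite /= (mk_monicE irr) rmodpp // irr.
by rewrite mulr0 add0r.
Qed.

Lemma mu_pullback_rmorphism (z : K) : z ^+ d = 1 ->
  exists m : {rmorphism L -> L}, forall h, mu_pullback z h = m h.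
Proof.
move=> zd.
have mB : zmod_morphism (mu_pullback (irr := irr) z).
  move=> g h; rewrite -[g]in_qpoly_id -[h]in_qpoly_id.
  rewrite -(rmorphB (in_qpoly phi)).
  by rewrite !mu_pullback_in_qpoly // comp_polyB (rmorphB (in_qpoly phi)).
have mM : monoid_morphism (mu_pullback (irr := irr) z).
  split; first by rewrite /mu_pullback comp_polyC in_qpoly1.
  move=> g h; rewrite -[g]in_qpoly_id -[h]in_qpoly_id.
  rewrite -(in_qpolyM phi).
  by rewrite !mu_pullback_in_qpoly // comp_polyM in_qpolyM.
pose m1 := GRing.isZmodMorphism.Build L L _ mB.
pose m2 := GRing.isMonoidMorphism.Build L L _ mM.
pose m : {rmorphism L -> L} := HB.pack (mu_pullback (irr := irr) z) m1 m2.
by exists m.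
Qed.

Lemma mu_pullback_poly_fun (z : K) p : mu_pullback z (c p) = c p.
Proof.
have -> : c p = in_qpoly phi (p%:F)%:P.
  by rewrite poly_funE // /bipoly_fun map_polyC.
by rewrite /mu_pullback /= [rmodp _ _]rmodp_small ?comp_polyC // mk_monicE // size_phi //
  size_polyC (leq_ltn_trans (leq_b1 _)) // ltnS ltnW.
Qed.

Lemma mu_pullback_y (z : K) : z ^+ d = 1 -> mu_pullback z y = c z%:P * y.
Proof.
move=> zd; rewrite /coord_y mu_pullback_in_qpoly // comp_polyX -mul_polyC in_qpolyM.
by rewrite poly_funE // /bipoly_fun map_polyC.
Qed.

Lemma mu_pullback_comp (z w : K) h : z ^+ d = 1 ->
  mu_pullback (irr := irr) z (mu_pullback w h) = mu_pullback (z * w) h.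
Proof.
move=> zd; rewrite {2}/mu_pullback mu_pullback_in_qpoly // /mu_pullback.
by rewrite -comp_polyA comp_polyZ comp_polyX scalerA -tofracM -polyCM mulrC.
Qed.

Lemma mu_pullback1 h : mu_pullback (irr := irr) 1 h = h.
Proof. by rewrite /mu_pullback polyC1 tofrac1 scale1r comp_polyXr in_qpoly_id. Qed.

Lemma point_valuation (P : curve_point irr) : valuation P.
Proof. by case: P => v [v0 vM vD]. Qed.

Lemma point_const (P : curve_point irr) (a : K) : a != 0 -> P (c a%:P) = 0.
Proof. by move=> a0; exact: (valuationC (ord_atP P) a0). Qed.

Lemma unity_root_neq0 (z : K) : z ^+ d = 1 -> z != 0.
Proof.
move=> zd; apply/eqP => z0; move/eqP: zd.
by rewrite z0 expr0n gtn_eqF ?(ltnW d_gt1) // eq_sym oner_eq0.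
Qed.

Fact mu_point_subproof (z : K) (zd : z ^+ d = 1) (P : curve_point irr) :
  discrete_valuation (fun h => P (mu_pullback z h)).
Proof.
have [m mE] := mu_pullback_rmorphism zd; have [v0 vM vD] := point_valuation P.
have mn0 g : g != 0 -> m g != 0 by rewrite fmorph_eq0.
have z0 := unity_root_neq0 zd.
have zV : z^-1 ^+ d = 1 by rewrite exprVn zd invr1.
have [t t0 Pt] := valuation_uniformizer (ord_atP P).
split.
- by rewrite mE rmorph0 v0.
- by move=> g h g0 h0; rewrite !mE rmorphM vM ?mn0.
- by move=> g h g0 h0 gh0; rewrite !mE rmorphD vD -?rmorphD ?mn0.
- by move=> a a0; rewrite mu_pullback_poly_fun (point_const P a0).
- exists (mu_pullback z^-1 t); last by rewrite mu_pullback_comp // divff // mu_pullback1.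
  by have [m' ->] := mu_pullback_rmorphism zV; rewrite fmorph_eq0.
Qed.

Definition mu_point (z : K) (zd : z ^+ d = 1) (P : curve_point irr) : curve_point irr :=
  CurvePoint (mu_point_subproof zd P).

Lemma mu_pointE (z : K) (zd : z ^+ d = 1) P h : mu_point zd P h = P (mu_pullback z h).
Proof. by []. Qed.

Lemma point_ext (P Q : curve_point irr) : (forall h, P h = Q h) -> P = Q.
Proof.
case: P Q => [v vP] [w wP] /= /funext E; rewrite E in vP *.
by congr CurvePoint; exact: Prop_irrelevance.
Qed.

Lemma mu_orbit_mu_point (z : K) (zd : z ^+ d = 1) P : mu_orbit (mu_point zd P) = mu_orbit P.
Proof.
have z0 := unity_root_neq0 zd.
apply/seteqP; split=> Q [w wd QE].
  exists (z * w); first by rewrite exprMn zd wd mulr1.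
  by move=> h; rewrite QE mu_pointE mu_pullback_comp.
exists (z^-1 * w); first by rewrite exprMn exprVn zd wd invr1 mulr1.
by move=> h; rewrite QE mu_pointE mu_pullback_comp // mulVKf.
Qed.

End Points.

Lemma coprime_addM_inj n d a b i j : coprime n d -> (i < d)%N -> (j < d)%N ->
  (a * d + n * i = b * d + n * j)%N -> i = j.
Proof.
move=> co_nd; wlog ij : a b i j / (i <= j)%N => [W|id jd E].
  case/orP: (leq_total i j) => ij id jd E; first exact: (W _ _ _ _ ij id jd E).
  by apply/esym; exact: (W _ _ _ _ ij jd id (esym E)).
have : (n * i == n * j %[mod d])%N by rewrite -(modnMDl a) E modnMDl.
rewrite eq_sym eqn_mod_dvd ?leq_mul // -mulnBr Gauss_dvdr 1?coprime_sym // => dv.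
have [|ji0] := posnP (j - i)%N; first lia.
by have := dvdn_leq ji0 dv; lia.
Qed.

Section Infinity.
Variables (K : closedFieldType) (d : nat) (f : {poly K}).
Variable irr : monic_irreducible_poly (superelliptic_poly d f).
Local Notation L := (function_field irr).
Local Notation y := (coord_y irr).
Local Notation c := (poly_fun irr).
Hypothesis d_gt1 : (1 < d)%N.
Variable n : nat.
Hypotheses (szf : size f = n.+1) (co_nd : coprime n d).

Lemma f_neq0 : f != 0.
Proof. by rewrite -size_poly_eq0 szf. Qed.

Lemma coord_y_neq0 : y != 0.
Proof.
have : y ^+ d != 0 by rewrite coord_yXd // poly_fun_eq0 f_neq0.
by rewrite expf_eq0 negb_and ltnW.
Qed.

Variable O : curve_point irr.
Hypothesis O_infty : at_infinity O.
Local Notation X := (O (coord_x irr)).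

Let XE : coord_x irr = c 'X. Proof. by []. Qed.

Lemma ord_infinity_poly p : p != 0 -> O (c p) = X *+ (size p).-1.
Proof.
move=> p0; rewrite XE; apply: val_poly_infinity => //.
- exact: point_valuation.
- exact: point_const.
- exact: poly_fun_eq0.
Qed.

Lemma ord_infinity_y : O y *+ d = X *+ n.
Proof.
rewrite -(valgX (point_valuation O)) ?coord_y_neq0 // coord_yXd //.
by rewrite ord_infinity_poly ?f_neq0 // szf.
Qed.

(* As n and d are coprime, the terms of [bipoly_fun G] have distinct pole orders. *)
Lemma ord_infinity_sum (G : {poly {poly K}}) : G != 0 -> (size G <= d)%N ->
  exists j, [/\ G`_j != 0, O (bipoly_fun irr G) = O (c G`_j * y ^+ j) &
    forall i, G`_i != 0 -> O (c G`_j * y ^+ j) <= O (c G`_i * y ^+ i)].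
Proof.
move=> G0 sG; have y0 := coord_y_neq0.
have tE (i : nat) : G`_i != 0 -> O (c G`_i * y ^+ i) = X *+ (size G`_i).-1 + O y *+ i.
  move=> Gi; have vO := point_valuation O.
  by rewrite (valgM vO) ?poly_fun_eq0 ?expf_neq0 // (valgX vO) // ord_infinity_poly.
have t0 (i : nat) : (c G`_i * y ^+ i == 0) = (G`_i == 0).
  by rewrite mulf_eq0 expf_eq0 (negPf y0) andbF orbF poly_fun_eq0.
have sc a i : (X *+ a + O y *+ i) *+ d = X *+ (a * d + n * i).
  by rewrite mulrnDl -mulrnA [O y *+ i *+ d]mulrnAC ord_infinity_y -mulrnA -mulrnDr.
have inj (i j : 'I_(size G)) : c G`_i * y ^+ i != 0 -> c G`_j * y ^+ j != 0 ->
    O (c G`_i * y ^+ i) = O (c G`_j * y ^+ j) -> i = j.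
  rewrite !t0 => Gi Gj; rewrite !tE // => /(congr1 (fun u => u *+ d)).
  rewrite !sc => E.
  have := O_infty; rewrite /at_infinity => X0.
  apply/val_inj; 
  apply: (@coprime_addM_inj n d (size G`_i).-1 (size G`_j).-1 _ _ co_nd).
  - exact: leq_trans (ltn_ord i) sG.
  - exact: leq_trans (ltn_ord j) sG.
  move: X0 E; move: (X) (_ + _)%N (_ + _)%N => x a b x0.
  rewrite -(mulr_natr x a) -(mulr_natr x b) => /(mulfI (ltr0_neq0 x0)) /eqP.
  by rewrite eqr_nat => /eqP.
have [|i [ti _ Oi min_i]] := val_sum_distinct (point_valuation O) inj.
  have s0 : (0 < size G)%N by rewrite lt0n size_poly_eq0.
  exists (Ordinal (n:=size G) (m:=(size G).-1) ltac:(by rewrite prednK)).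
  by rewrite t0 /= -lead_coefE lead_coef_eq0.
exists i; split; first by rewrite -t0.
  by rewrite bipoly_fun_sum.
move=> k Gk; have kG : (k < size G)%N.
  by rewrite ltnNge; apply: contraNN Gk => /leq_sizeP -> //.
by apply: (min_i (Ordinal kG)); rewrite t0.
Qed.

(* A priori x and y have orders - d k and - n k for some k > 0; all orders are
   then multiples of k, so the existence of a uniformizer gives k = 1. *)
Lemma ord_infinity_xy : X = - d%:Z /\ O y = - n%:Z.
Proof.
have vO := point_valuation O; have d_gt0 := ltnW d_gt1.
have [k [Xk Yk]] : exists k : nat, X = - (d * k)%N%:Z /\ O y = - (n * k)%N%:Z.
  have := ord_infinity_y; have := O_infty; rewrite /at_infinity.
  move: (X) (O y) => x w x0 E.
  have xE : x = - `|x|%N%:Z by lia.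
  have wE : w = - `|w|%N%:Z by move: E; rewrite -(mulr_natr w) -(mulr_natr x); nia.
  have {}E : (`|w| * d = `|x| * n)%N.
    by move: E; rewrite -(mulr_natr w) -(mulr_natr x) {1}xE {1}wE; nia.
  have /dvdnP[k kE] : (d %| `|x|)%N.
    by rewrite -(@Gauss_dvdl d _ n) 1?coprime_sym // -E dvdn_mull.
  exists k; rewrite xE wE kE mulnC; split=> //; congr (- Posz _).
  by apply/eqP; rewrite -(eqn_pmul2r d_gt0) E kE; apply/eqP; ring.
have [t t0 Ot] := valuation_uniformizer (ord_atP O).
have [G [p [sG p0 tG]]] := function_repr d_gt1 t.
have cp0 : c p != 0 by rewrite poly_fun_eq0.
have G0 : G != 0.
  by apply: contraNneq t0 => G0; move/eqP: tG; rewrite G0 rmorph0 mulf_eq0 (negPf cp0) orbF.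
have [j [Gj Oj _]] := ord_infinity_sum G0 sG.
have := valgM vO t0 cp0; rewrite tG Oj (valgM vO) ?poly_fun_eq0 ?expf_neq0 ?coord_y_neq0 //.
rewrite (valgX vO) ?coord_y_neq0 // (ord_infinity_poly p0) (ord_infinity_poly Gj) Ot Xk Yk.
move: (size _).-1 (size _).-1 => a b.
rewrite -(mulr_natr _ a) -(mulr_natr _ b) -(mulr_natr _ j) => E.
have k1 : k%:Z * (d%:Z * a%:Z - d%:Z * b%:Z - n%:Z * j%:Z) = 1.
  apply/eqP; rewrite -subr_eq0; move/eqP: E; rewrite -subr_eq0 => /eqP <-.
  by apply/eqP; rewrite !natz !PoszM; ring.
suff -> : k = 1%N by rewrite !muln1.
have : (k%:Z %| 1)%Z by apply/dvdzP; eexists; rewrite mulrC; apply/esym; exact: k1.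
by rewrite dvdz1 => /eqP.
Qed.

Lemma ord_infinity_term (p : {poly K}) j : p != 0 ->
  O (c p * y ^+ j) = - (d * (size p).-1 + n * j)%N%:Z.
Proof.
move=> p0; have vO := point_valuation O; have [X_d Y_n] := ord_infinity_xy.
rewrite (valgM vO) ?poly_fun_eq0 ?expf_neq0 ?coord_y_neq0 //.
rewrite (valgX vO) ?coord_y_neq0 // ord_infinity_poly // X_d Y_n.
by rewrite !mulNrn -opprD -(mulr_natr d%:Z) -(mulr_natr n%:Z) !natz.
Qed.

End Infinity.

(** * Existence of a point with a given abscissa *)

Lemma generator_combination (R : comNzRingType) (s1 s2 g1 q1 q2 u v t h1 h2 : R) :
  s1 * h1 = t * g1 -> s2 * h2 = t * v * u ->
  s1 * s2 * (q1 * h1 + q2 * h2) = t * (s2 * g1 * q1 + s1 * v * u * q2).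
Proof.
move=> E1 E2; have -> : s1 * s2 * (q1 * h1 + q2 * h2) =
  s2 * q1 * (s1 * h1) + s1 * q2 * (s2 * h2) by ring.
by rewrite E1 E2; ring.
Qed.

Lemma int_le_addn (k l : int) : k <= l -> exists r : nat, l = k + r%:Z.
Proof. by move=> kl; exists `|l - k|%N; lia. Qed.

Lemma order_combination (R : comNzRingType) (s s' s2 g h t t' u u' : R) :
  s * g = t * u -> s' * h = t * t' * u' ->
  s2 * (g + h) * (s * s') = t * (s2 * (s' * u + s * t' * u')).
Proof.
move=> E1 E2; have -> : s2 * (g + h) * (s * s') =
  s2 * (s' * (s * g) + s * (s' * h)) by ring.
by rewrite E1 E2; ring.
Qed.

Section Place.
Variables (K : closedFieldType) (d : nat) (f : {poly K}).
Variable irr : monic_irreducible_poly (superelliptic_poly d f).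
Local Notation L := (function_field irr).
Local Notation y := (coord_y irr).
Local Notation c := (poly_fun irr).
Local Notation ev := (bipoly_fun irr).
Hypothesis d_gt1 : (1 < d)%N.
Hypothesis charK : [pchar K] =i pred0.
Hypothesis simple_roots_f : forall a : K, (mup a f <= 1)%N.
Hypothesis f0 : f != 0.
Variables (b e : K).
Hypothesis be_on_curve : e ^+ d = f.[b].

Definition eval_at (G : {poly {poly K}}) : K := G.[e%:P].[b].

Lemma eval_atB G H : eval_at (G - H) = eval_at G - eval_at H.
Proof. by rewrite /eval_at !hornerD !hornerN. Qed.

Lemma eval_atM G H : eval_at (G * H) = eval_at G * eval_at H.
Proof. by rewrite /eval_at !hornerM. Qed.

Lemma eval_at1 : eval_at 1 = 1.
Proof. by rewrite /eval_at !hornerE. Qed.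

Lemma eval_at_ker G : ev G = 0 -> eval_at G = 0.
Proof.
move=> /(bipoly_fun_ker d_gt1)[Q ->]; rewrite eval_atM /eval_at !hornerE.
by rewrite be_on_curve subrr mulr0.
Qed.

Lemma bipoly_fun_neq0 G : eval_at G != 0 -> ev G != 0.
Proof. by apply: contraNneq => /eval_at_ker ->. Qed.

(* The maximal ideal of the local ring at (b, e) is generated by the function
   of [T]: the coordinate x - b if e <> 0, and y if e = 0. *)
Lemma uniformizer_at : exists (T S1 G1 S2 U2 : {poly {poly K}}) (k : nat),
  [/\ eval_at T = 0, eval_at S1 != 0, eval_at S2 != 0 & eval_at U2 != 0] /\
  (ev S1 * ev ('X - e%:P%:P) = ev T * ev G1 /\
   ev S2 * c ('X - b%:P) = ev T ^+ k.+1 * ev U2).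
Proof.
have ev1 : ev 1 = 1 := rmorph1 _.
have [e0|e0] := eqVneq e 0.
  have fb : f.[b] = 0 by rewrite -be_on_curve e0 expr0n gtn_eqF // ltnW.
  have /factor_theorem[f1 fE] : root f b by rewrite rootE fb.
  exists 'X, 1, 1, f1%:P, 1, d.-1; split; first split.
  - by rewrite /eval_at !hornerE.
  - by rewrite /eval_at !hornerE oner_neq0.
  - rewrite /eval_at hornerC; apply/negP => /eqP f1b.
    have := simple_roots_f b; rewrite leqNgt mup_geq // fE.
    by rewrite expr2 dvdp_mul // dvdp_XsubCl rootE f1b.
  - by rewrite /eval_at !hornerE oner_neq0.
  rewrite ev1 e0 !mulr1 mul1r subr0; split=> //.
  by rewrite -poly_funE // -rmorphM -fE (prednK (ltnW d_gt1)) bipoly_funX coord_yXd.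
pose g := 'X^d - (e ^+ d)%:P%:P : {poly {poly K}}.
have /factor_theorem[S SE] : root g e%:P by rewrite rootE /g !hornerE rmorphXn subrr.
have /factor_theorem[q qE] : root (f - (e ^+ d)%:P) b.
  by rewrite rootE !hornerE be_on_curve subrr.
exists ('X - b%:P)%:P, S, q%:P, 1, 1, 0%N; split; first split.
- by rewrite /eval_at !hornerE subrr.
- have /(congr1 (fun G => G^`().[e%:P])) := SE.
  rewrite /g derivB derivC subr0 derivXn derivM derivXsubC !hornerE subrr mulr0 add0r.
  rewrite hornerMn hornerXn => /(congr1 (fun p => p.[b])).
  rewrite hornerMn -rmorphXn hornerC /eval_at => <-.
  by rewrite -mulr_natr mulf_neq0 ?expf_neq0 // ((pcharf0P K).1 charK) -lt0n ltnW.
- by rewrite /eval_at !hornerE oner_neq0.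
- by rewrite /eval_at !hornerE oner_neq0.
rewrite ev1 mul1r mulr1 expr1 -poly_funE //; split=> //.
rewrite -rmorphM -SE -poly_funE // -rmorphM mulrC -qE /g !rmorphB rmorphXn /=.
by rewrite bipoly_funX coord_yXd // -poly_funE.
Qed.

Section NormalForm.
Variables (T S1 G1 S2 U2 : {poly {poly K}}) (m : nat).
Hypotheses (T0 : eval_at T = 0) (S10 : eval_at S1 != 0).
Hypotheses (S20 : eval_at S2 != 0) (U20 : eval_at U2 != 0).
Hypothesis y_e : ev S1 * ev ('X - e%:P%:P) = ev T * ev G1.
Hypothesis x_b : ev S2 * c ('X - b%:P) = ev T ^+ m.+1 * ev U2.
Local Notation t := (ev T).

Lemma uniformizer_neq0 : t != 0.
Proof.
have : ev S2 * c ('X - b%:P) != 0.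
  by rewrite mulf_neq0 ?bipoly_fun_neq0 // poly_fun_eq0 polyXsubC_eq0.
by rewrite x_b mulf_eq0 expf_eq0 negb_or => /andP[].
Qed.

Definition order_at (h : L) (k : int) : Prop := exists S U : {poly {poly K}},
  [/\ eval_at S != 0, eval_at U != 0 & ev S * h = t ^ k * ev U].

Lemma order_compare (k l : int) (A B : {poly {poly K}}) : eval_at A != 0 ->
  t ^ k * ev A = t ^ l * ev B -> l <= k.
Proof.
move=> A0 E; rewrite leNgt; apply/negP => kl.
have tk0 : t ^ k != 0 by rewrite expfz_neq0 // uniformizer_neq0.
have [r lE] : exists r : nat, l = (k + 1) + r%:Z by apply: int_le_addn; rewrite -lezD1 in kl.
have {}lE : l = k + r.+1%:Z by rewrite lE -addrA.
move: E; rewrite lE expfzDr ?uniformizer_neq0 // -mulrA => /(mulfI tk0).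
rewrite -exprnP => {}E; have : ev (A - T ^+ r.+1 * B) = 0.
  by rewrite bipoly_funB bipoly_funM bipoly_fun_exp E subrr.
move/eval_at_ker/eqP; rewrite eval_atB eval_atM exprS eval_atM T0 !mul0r subr0.
by rewrite (negPf A0).
Qed.

Lemma order_unique h (k l : int) : order_at h k -> order_at h l -> k = l.
Proof.
move=> [S [U [S0 U0 E]]] [S' [U' [S'0 U'0 E']]].
have : t ^ k * ev (U * S') = t ^ l * ev (U' * S).
  by rewrite !bipoly_funM !mulrA -E -E' mulrAC [RHS]mulrC mulrA.
move=> EE; apply/eqP; rewrite eq_le (order_compare _ EE) ?(order_compare _ (esym EE)) //.
all: by rewrite eval_atM mulf_neq0.
Qed.

Lemma order_atM g h (k l : int) :
  order_at g k -> order_at h l -> order_at (g * h) (k + l).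
Proof.
move=> [S [U [S0 U0 E]]] [S' [U' [S'0 U'0 E']]].
exists (S * S'), (U * U'); rewrite !eval_atM !mulf_neq0 //; split=> //.
by rewrite !bipoly_funM expfzDr ?uniformizer_neq0 // mulrACA E E' mulrACA.
Qed.

Lemma order_atV h (k : int) : h != 0 -> order_at h k -> order_at h^-1 (- k).
Proof.
move=> h0 [S [U [S0 U0 E]]]; exists U, S; split=> //.
apply: (mulIf h0); rewrite mulfVK // -mulrA E mulrA -expfzDr ?uniformizer_neq0 //.
by rewrite addNr expr0z mul1r.
Qed.

Lemma order_at_unit G : eval_at G != 0 -> order_at (ev G) 0.
Proof.
by move=> G0; exists 1, G; rewrite eval_at1 oner_neq0 expr0z bipoly_fun1 mul1r.
Qed.

Lemma order_at_uniformizer : order_at t 1.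
Proof.
by exists 1, 1; rewrite eval_at1 oner_neq0 expr1z bipoly_fun1 mul1r mulr1.
Qed.

Lemma order_at_linear : order_at (c ('X - b%:P)) m.+1.
Proof. by exists S2, U2. Qed.

Lemma order_at_poly p : p != 0 -> exists k : nat, order_at (c p) k.
Proof.
have [s] := ubnP (size p); elim: s p => // s IHs p /ltnSE ps p0.
have [pb|pb] := eqVneq p.[b] 0; last first.
  by exists 0%N; rewrite poly_funE //; apply: order_at_unit; rewrite /eval_at hornerC.
have /factor_theorem[q qE] : root p b by rewrite rootE pb.
have q0 : q != 0 by apply: contraNneq p0 => q0; rewrite qE q0 mul0r.
have [|k qk] := IHs q _ q0.
  by move: ps; rewrite qE size_mul ?polyXsubC_eq0 // size_XsubC addn2.
by exists (k + m.+1)%N; rewrite qE poly_funM PoszD; apply: order_atM => //;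
   exact: order_at_linear.
Qed.

Lemma vanishing_divisible G : eval_at G = 0 -> exists S G' : {poly {poly K}},
  eval_at S != 0 /\ ev S * ev G = t * ev G'.
Proof.
move=> G0; have /factor_theorem[Q QE] : root (G - (G.[e%:P])%:P) e%:P.
  by rewrite rootE !hornerE subrr.
have /factor_theorem[q qE] : root (G.[e%:P]) b by rewrite rootE; apply/eqP.
exists (S1 * S2), (S2 * G1 * Q + S1 * T ^+ m * U2 * q%:P).
rewrite eval_atM mulf_neq0 //; split=> //.
rewrite -[G](subrK (G.[e%:P])%:P) QE qE polyCM.
rewrite [ev (Q * _ + _)]bipoly_funD [ev (_ * Q + _)]bipoly_funD !bipoly_funM bipoly_fun_exp.
apply: (@generator_combination L _ _ _ (ev Q) (ev q%:P) _ _ t _ _ y_e).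
by rewrite -exprS -poly_funE.
Qed.

(* Factors of the uniformizer can be split off as long as the cofactor vanishes
   at (b, e); this stops because [ev G] divides a nonzero polynomial in x. *)
Lemma order_at_bipoly G : ev G != 0 -> exists k : nat, order_at (ev G) k.
Proof.
move=> G0; have [H [p [_ p0 HE]]] := function_repr d_gt1 (ev G)^-1.
have [k0 [S' [U' [S'0 U'0 E']]]] := order_at_poly p0.
have bound k S U : eval_at S != 0 -> ev S * ev G = t ^+ k * ev U -> (k <= k0)%N.
  move=> S0 E; rewrite -lez_nat.
  apply: (@order_compare _ _ (S * U') (S' * U * H)); first by rewrite eval_atM mulf_neq0.
  rewrite !bipoly_funM -HE -!exprnP mulrCA -E'.
  rewrite [RHS]mulrA [t ^+ k * _]mulrCA -E -!mulrA [ev G * _]mulrA divff // mul1r.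
  by rewrite mulrCA.
apply: contrapT => nok.
suff [S [U [S0 E]]] : exists S U, eval_at S != 0 /\ ev S * ev G = t ^+ k0.+1 * ev U.
  by have := bound _ _ _ S0 E; rewrite ltnn.
elim: k0.+1 => [|k [S [U [S0 E]]]].
  by exists 1, G; rewrite eval_at1 oner_neq0 bipoly_fun1 mul1r.
have [U0|U0] := eqVneq (eval_at U) 0; last by case: nok; exists k, S, U.
have [S'' [U'' [S''0 E'']]] := vanishing_divisible U0.
exists (S'' * S), U''; rewrite eval_atM mulf_neq0 //; split=> //.
by rewrite bipoly_funM -mulrA E mulrCA E'' mulrA exprSr.
Qed.

Lemma order_at_exists h : h != 0 -> exists k, order_at h k.
Proof.
move=> h0; have [G [p [_ p0 E]]] := function_repr d_gt1 h.
have cp0 : c p != 0 by rewrite poly_fun_eq0.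
have [|k Gk] := @order_at_bipoly G; first by rewrite -E mulf_neq0.
have [l pl] := order_at_poly p0; exists (k%:Z - l%:Z).
by rewrite -[h](mulfK cp0) E; apply: order_atM => //; apply: order_atV.
Qed.

Lemma order_atD g h (k l j : int) : g + h != 0 ->
  order_at g k -> order_at h l -> order_at (g + h) j -> Num.min k l <= j.
Proof.
wlog kl : g h k l / k <= l => [W gh0 gk hl ghj|].
  have [kl|/ltW lk] := leP k l; first by have := W _ _ _ _ kl gh0 gk hl ghj; rewrite min_l.
  by have := W _ _ _ _ lk _ hl gk; rewrite addrC min_l //; apply.
move=> gh0 [S [U [S0 U0 E]]] [S' [U' [S'0 U'0 E']]] [S'' [U'' [S''0 U''0 E'']]].
rewrite min_l //; have [r lE] := int_le_addn kl.
apply: (@order_compare _ _ (U'' * (S * S')) (S'' * (S' * U + S * T ^+ r * U'))).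
  by rewrite !eval_atM !mulf_neq0.
rewrite !(bipoly_funM, bipoly_funD, bipoly_fun_exp) [LHS]mulrA -E''.
move: E'; rewrite lE expfzDr ?uniformizer_neq0 // -exprnP => E'.
apply: (@order_combination L _ _ (ev S'') _ _ _ _ _ _ E E').
Qed.

Lemma place_exists : exists P : curve_point irr, 0 < P (c ('X - b%:P)).
Proof.
have /boolp.choice[v vE] (h : L) : exists k : int,
    (h == 0 /\ k = 0) \/ (h != 0 /\ order_at h k).
  have [->|h0] := eqVneq h 0; first by exists 0; left.
  by have [k hk] := order_at_exists h0; exists k; right.
have v0 : v 0 = 0 by case: (vE 0) => [[]|[]] //; rewrite eqxx.
have vO h : h != 0 -> order_at h (v h) by case: (vE h) => [[->]|[]].
have vP : discrete_valuation v.
  split=> //.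
  - move=> g h g0 h0; apply: (order_unique (vO _ (mulf_neq0 g0 h0))).
    by apply: order_atM; exact: vO.
  - by move=> g h g0 h0 gh0; apply: (order_atD gh0); exact: vO.
  - move=> a a0; have ca0 : c a%:P != 0 by rewrite poly_fun_eq0 polyC_eq0.
    apply: (order_unique (vO _ ca0)); rewrite poly_funE //; apply: order_at_unit.
    by rewrite /eval_at !hornerC.
  - exists t; first exact: uniformizer_neq0.
    by apply: (order_unique (vO _ uniformizer_neq0)); exact: order_at_uniformizer.
have xb0 : c ('X - b%:P) != 0 by rewrite poly_fun_eq0 polyXsubC_eq0.
by exists (CurvePoint vP); rewrite /= (order_unique (vO _ xb0) order_at_linear).
Qed.

End NormalForm.
End Place.

Lemma point_over_exists (K : closedFieldType) (d : nat) (f : {poly K})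
    (irr : monic_irreducible_poly (superelliptic_poly d f)) (b : K) :
    (1 < d)%N -> [pchar K] =i pred0 -> (forall a : K, (mup a f <= 1)%N) -> f != 0 ->
  exists P : curve_point irr, 0 < P (poly_fun irr ('X - b%:P)).
Proof.
move=> d1 charK sf f0; have [e be] : exists e, e ^+ d = f.[b].
  have /closed_rootP[e] : size ('X^d - f.[b]%:P) != 1.
    by rewrite size_XnsubC ?(ltnW d1) // eqSS -lt0n ltnW.
  by rewrite rootE !hornerE subr_eq0 => /eqP E; exists e.
have [T [S1 [G1 [S2 [U2 [m [[T0 S10 S20 U20] [E1 E2]]]]]]]] :=
  uniformizer_at irr d1 charK sf f0 be.
exact: (place_exists d1 be T0 S10 S20 U20 E1 E2).
Qed.

(** * Functions attached to torsion packets *)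

Lemma primitive_root_exists (K : closedFieldType) d : (0 < d)%N -> [pchar K] =i pred0 ->
  exists z : K, d.-primitive_root z.
Proof.
move=> d0 charK; have [rs E] := closed_field_poly_normal ('X^d - 1 : {poly K}).
have p0 : 'X^d - 1 != 0 :> {poly K} by rewrite monic_neq0 // monicXnsubC.
have lc : lead_coef ('X^d - 1 : {poly K}) = 1 by apply/eqP; rewrite -monicE monicXnsubC.
rewrite lc scale1r in E.
have urs : uniq rs.
  rewrite -separable_prod_XsubC -E separable_Xn_sub_1 //.
  by rewrite ((pcharf0P K).1 charK) -lt0n.
have : has d.-primitive_root rs.
  apply: has_prim_root => //.
    apply/allP => x xrs; rewrite unity_rootE -subr_eq0.
    have : root ('X^d - 1) x by rewrite E root_prod_XsubC.
    by rewrite rootE !hornerE.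
  have := congr1 (fun p : {poly K} => size p) E; rewrite size_XnsubC // size_prod_XsubC.
  by move=> [->].
by case/hasP => z _ zP; exists z.
Qed.

Section Torsion.
Variables (K : closedFieldType) (d : nat) (f : {poly K}).
Variable irr : monic_irreducible_poly (superelliptic_poly d f).
Local Notation L := (function_field irr).
Local Notation y := (coord_y irr).
Local Notation c := (poly_fun irr).
Local Notation ev := (bipoly_fun irr).

Lemma torsion_function (O P : curve_point irr) m : jacobian_embedding O P *+ m = 0 ->
  exists2 h : L, h != 0 & forall R : curve_point irr, 
    R h = ((P == R)%:R - (O == R)%:R) *+ m.
Proof.
rewrite /jacobian_embedding -raddfMn => /eqP.
set D := Divisor0 _; rewrite -(raddf0 (\pi_(jacobian irr))%qT).
move/eqP/eqquotP.
rewrite /Quotient.equiv subr0 => /asboolP[h h0 hE]; exists h => // R.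
rewrite -hE.
have -> : divisor (D *+ m) = divisor D *+ m by exact: (raddfMn val).
by rewrite coeffMn coeffB !coeffU !mul1r.
Qed.

Lemma jacobian_embedding0 (O : curve_point irr) : jacobian_embedding O O = 0.
Proof.
rewrite /jacobian_embedding -(raddf0 (\pi_(jacobian irr))%qT); congr (\pi_ _)%qT.
by apply: val_inj; rewrite /= subrr.
Qed.

End Torsion.

Section Integral.
Variables (K : closedFieldType) (d : nat) (f : {poly K}).
Variable irr : monic_irreducible_poly (superelliptic_poly d f).
Local Notation L := (function_field irr).
Local Notation y := (coord_y irr).
Local Notation c := (poly_fun irr).
Local Notation ev := (bipoly_fun irr).
Hypothesis d_gt1 : (1 < d)%N.
Hypothesis charK : [pchar K] =i pred0.
Hypothesis simple_roots_f : forall a : K, (mup a f <= 1)%N.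
Hypothesis f0 : f != 0.

Lemma mu_pullback_bipoly (z : K) (G : {poly {poly K}}) : z ^+ d = 1 ->
  mu_pullback z (ev G) = \sum_(j < size G) c (z ^+ j)%:P * (c G`_j * y ^+ j).
Proof.
move=> zd; have [m mE] := mu_pullback_rmorphism irr zd.
have mc p : m (c p) = c p by rewrite -mE mu_pullback_poly_fun.
have my : m y = c z%:P * y by rewrite -mE mu_pullback_y.
rewrite mE bipoly_fun_sum // rmorph_sum; apply: eq_bigr => j _.
by rewrite rmorphM rmorphXn /= mc my exprMn -poly_fun_exp -rmorphXn mulrCA.
Qed.

Lemma sum_unity_root (R : fieldType) (w : R) : w ^+ d = 1 -> w != 1 ->
  \sum_(i < d) w ^+ i = 0.
Proof.
move=> wd w1; apply/eqP; have := subrX1 w d.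
by rewrite wd subrr => /esym/eqP; rewrite mulf_eq0 subr_eq0 (negPf w1).
Qed.

(* The monomials of [ev G] are the eigencomponents of the action of mu_d. *)
Lemma eigencomponent (z : K) (G : {poly {poly K}}) j : d.-primitive_root z ->
  (size G <= d)%N -> (j < d)%N ->
  \sum_(i < d) c (z ^- (i * j))%:P * mu_pullback (z ^+ i) (ev G) =
  c d%:R * (c G`_j * y ^+ j).
Proof.
move=> zP sG jd; have zd := prim_expr_order zP.
have z0 : z != 0 := unity_root_neq0 d_gt1 zd.
have zid i : (z ^+ i) ^+ d = 1 by rewrite exprAC zd expr1n.
transitivity (\sum_(k < size G)
    (c (\sum_(i < d) (z ^+ k / z ^+ j) ^+ i)%:P) * (c G`_k * y ^+ k)).
  under eq_bigr do rewrite mu_pullback_bipoly // mulr_sumr.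
  rewrite exchange_big; apply: eq_bigr => k _ /=.
  rewrite !rmorph_sum mulr_suml; apply: eq_bigr => i _ /=.
  have -> : (z ^+ k / z ^+ j) ^+ i = z ^- (i * j) * (z ^+ i) ^+ k.
    by rewrite exprMn exprVn -!exprM mulrC [(k * i)%N]mulnC [(j * i)%N]mulnC.
  by rewrite polyCM poly_funM mulrA.
have sum0 (k : nat) : (k < d)%N -> k != j -> \sum_(i < d) (z ^+ k / z ^+ j) ^+ i = 0.
  move=> kd kj; apply: sum_unity_root; first by rewrite exprMn exprVn !zid invr1 mulr1.
  apply: contra kj => /eqP E; have := eq_prim_root_expr zP k j.
  rewrite !modn_small // => <-; apply/eqP.
  by rewrite -[LHS](mulfVK (expf_neq0 j z0)) E mul1r.
have sumj : \sum_(i < d) (z ^+ j / z ^+ j) ^+ i = d%:R.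
  under eq_bigr do rewrite divff ?expf_neq0 // expr1n.
  by rewrite sumr_const card_ord.
have [jG|jG] := ltnP j (size G).
  rewrite (bigD1 (Ordinal jG)) //= sumj big1 ?addr0 ?rmorph_nat // => k kj.
  by rewrite sum0 ?mul0r ?rmorph0 // ?mul0r // (leq_trans (ltn_ord k)).
rewrite big1 => [|k _]; first by rewrite nth_default // rmorph0 mul0r mulr0.
rewrite sum0 ?rmorph0 ?mul0r // ?(leq_trans (ltn_ord k)) //.
by rewrite neq_ltn (leq_trans (ltn_ord k) jG).
Qed.

Lemma ord_y_le (P : curve_point irr) b : 0 < P (c ('X - b%:P)) ->
  P y *+ d <= P (c ('X - b%:P)).
Proof.
move=> Pb; have y0 : y != 0.
  have : y ^+ d != 0 by rewrite coord_yXd // poly_fun_eq0.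
  by rewrite expf_eq0 negb_and ltnW.
rewrite -(valgX (point_valuation P)) // coord_yXd //.
apply: (val_poly_simple (point_valuation P)) => //.
- exact: point_const.
- exact: poly_fun_eq0.
Qed.

(* If the denominator of [h] vanishes at b, then so do all the coefficients of
   its numerator, since the order of y^j over b is less than that of x - b when
   j < d (f has simple roots); hence x - b cancels. *)
Lemma integral_bipoly (h : L) :
    (forall (P : curve_point irr) b, 0 < P (c ('X - b%:P)) -> vge P 0 h) ->
  exists2 G : {poly {poly K}}, (size G <= d)%N & h = ev G.
Proof.
move=> hP; have [G [p [sG p0 hE]]] := function_repr d_gt1 h.
have [s] := ubnP (size p); elim: s => // s IHs in p p0 G sG hE *.
move=> /ltnSE ps.
have [p1|p1] := eqVneq (size p) 1%N.
  have /size_poly1P[a a0 pE] : size p == 1%N by rewrite p1.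
  exists (a^-1%:P *: G); first by rewrite (leq_trans (size_scale_leq _ _)).
  rewrite -mul_polyC bipoly_funM -hE pE -poly_funE // mulrCA -poly_funM -polyCM mulVf //.
  by rewrite polyC1 rmorph1 mulr1.
have /closed_rootP[b pb] := p1.
have [P Pb] := point_over_exists irr b d_gt1 charK simple_roots_f f0.
have vP := point_valuation P.
have cP : forall a : K, a != 0 -> P (c a%:P) = 0 by exact: point_const.
have c_eq0 : forall p, (c p == 0) = (p == 0) by exact: poly_fun_eq0.
have [z zP] := primitive_root_exists (ltnW d_gt1) charK.
have y0 : y != 0.
  have : y ^+ d != 0 by rewrite coord_yXd // poly_fun_eq0.
  by rewrite expf_eq0 negb_and ltnW.
have Gb j : root G`_j b.
  have [dj|jd] := leqP d j.
    by rewrite nth_default ?root0 // (leq_trans sG).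
  apply/negPn/negP => Gjb.
  have Gj0 : G`_j != 0 by apply: contraNneq Gjb => ->; rewrite root0.
  have : vge P (P (c ('X - b%:P))) (c d%:R * (c G`_j * y ^+ j)).
    rewrite -(eigencomponent zP sG jd); apply: (vge_sum vP) => i _.
    have zi : (z ^+ i) ^+ d = 1 by rewrite exprAC (prim_expr_order zP) expr1n.
    rewrite -[X in vge _ X]add0r; apply: (vgeM vP); first exact: (vge_const cP c_eq0).
    rewrite -hE; have [m mE] := mu_pullback_rmorphism irr zi.
    rewrite mE rmorphM -!mE mu_pullback_poly_fun // -[X in vge _ X]add0r.
    apply: (vgeM vP); last by apply: (val_poly_root vP cP c_eq0 Pb); apply/eqP.
    have /hP : 0 < mu_point d_gt1 zi P (c ('X - b%:P)).
      by rewrite mu_pointE mu_pullback_poly_fun.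
    by rewrite /vge mu_pointE mE fmorph_eq0.
  have dK : d%:R != 0 :> K by rewrite ((pcharf0P K).1 charK) -lt0n ltnW.
  have dE : c d%:R = c (d%:R)%:P by rewrite polyC_natr.
  have cd0 : c d%:R != 0 by rewrite dE c_eq0 polyC_eq0.
  have g0 : c G`_j != 0 by rewrite c_eq0.
  have yj0 : y ^+ j != 0 by exact: expf_neq0.
  have gy0 := mulf_neq0 g0 yj0.
  rewrite (vgeE _ _ (mulf_neq0 cd0 gy0)) (valgM vP cd0 gy0) (valgM vP g0 yj0).
  rewrite (valgX vP _ y0).
  rewrite dE (cP _ dK) (val_poly_nonroot vP cP c_eq0 Pb Gjb) !add0r.
  have := ord_y_le Pb; move: Pb; move: (P (c _)) (P y) => e w.
  rewrite -(mulr_natr w d) -(mulr_natr w j) !natz => e0 we le.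
  have we' : w * d%:Z * j%:Z <= e * j%:Z by rewrite ler_wpM2r.
  have le' : e * d%:Z <= w * j%:Z * d%:Z by rewrite ler_wpM2r.
  have : e * d%:Z <= e * j%:Z by apply: (le_trans le'); rewrite mulrAC.
  by rewrite (ler_pM2l e0) lez_nat leqNgt jd.
have /factor_theorem[q qE] := pb.
have q0 : q != 0 by apply: contraNneq p0 => q0; rewrite qE q0 mul0r.
pose H := \poly_(j < size G) (G`_j %/ ('X - b%:P)).
have GH : G = ('X - b%:P) *: H.
  apply/polyP => j; rewrite coefZ coef_poly.
  have [jG|jG] := ltnP j (size G); last by rewrite nth_default // mulr0.
  by rewrite mulrC divpK // dvdp_XsubCl.
apply: (IHs q q0 H).
- exact: leq_trans (size_poly _ _) sG.
- have X0 : c ('X - b%:P) != 0 by rewrite poly_fun_eq0 polyXsubC_eq0.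
  apply: (mulIf X0); rewrite -mulrA -poly_funM -qE hE GH -mul_polyC bipoly_funM.
  by rewrite -poly_funE // mulrC.
- by move: ps; rewrite qE size_mul ?polyXsubC_eq0 // size_XsubC addn2.
Qed.

End Integral.

Lemma subrXX_prim (F : fieldType) d (z x y : F) : d.-primitive_root z -> y != 0 ->
  x ^+ d - y ^+ d = \prod_(i < d) (x - z ^+ i * y).
Proof.
move=> zP y0; have := congr1 (fun p => p.[x / y]) (factor_Xn_sub_1 zP).
rewrite big_mkord horner_prod !hornerE => E.
rewrite -[x in LHS](mulfVK y0) exprMn -[X in _ - X]mul1r -mulrBl -E.
rewrite -[in y ^+ d](card_ord d) -prodr_const -big_split; apply: eq_bigr => i _ /=.
by rewrite !hornerE mulrBl mulfVK.
Qed.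

Lemma valg_prod_le0 (L : fieldType) (v : L -> int) n (t : 'I_n -> L) : valuation v ->
  (forall i, t i != 0 /\ v (t i) <= 0) -> v (\prod_i t i) <= 0.
Proof.
move=> vP tP; suff [] : \prod_i t i != 0 /\ v (\prod_i t i) <= 0 by [].
elim/big_ind: _ => // [|g h [g0 gv] [h0 hv]]; first by rewrite oner_neq0 (valg1 vP).
by rewrite mulf_neq0 // (valgM vP) // -[0]addr0 lerD.
Qed.

Lemma degree_arith n d l : (1 < d)%N -> coprime n d -> (n < d * l)%N ->
  (d * l < n + d)%N -> (d * l)%N <> n.+1 -> (2 * (d - 2) * l <= n)%N -> d = 3%N.
Proof.
move=> d1 co lt1 lt2 ne le; have d4 : (d < 4)%N by nia.
by case: d d1 d4 co lt1 lt2 ne le => [|[|[|[|d]]]] // _ _ _; lia.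
Qed.

Section SameOrbit.
Variables (K : closedFieldType) (d : nat) (f : {poly K}).
Variable irr : monic_irreducible_poly (superelliptic_poly d f).
Local Notation y := (coord_y irr).
Local Notation c := (poly_fun irr).
Hypothesis d_gt1 : (1 < d)%N.

(* If [v2 a = z v1 a] then both [v2 - v2 a] and [y - v1 a] vanish at P, hence
   so does [v2 - z y], the pullback of [v2 - y]. *)
Lemma mu_orbit_eq (P Q : curve_point irr) (a : K) (v1 v2 : {poly K}) :
    v1.[a] ^+ d = v2.[a] ^+ d -> 0 < P (c ('X - a%:P)) -> 0 < P (c v1 - y) ->
    c v2 - y != 0 -> (forall R : curve_point irr, 0 < R (c v2 - y) -> R = Q) ->
  mu_orbit P = mu_orbit Q.
Proof.
move=> v12 Pa Pv w0 Qu; have vP := point_valuation P.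
have [z [zd zE]] : exists z : K, z ^+ d = 1 /\ v2.[a] = z * v1.[a].
  have [v10|v10] := eqVneq v1.[a] 0.
    exists 1; rewrite expr1n v10 mulr0; split=> //; apply/eqP.
    by have /eqP := v12; rewrite v10 expr0n gtn_eqF ?(ltnW d_gt1) // eq_sym
      expf_eq0 => /andP[].
  exists (v2.[a] / v1.[a]); rewrite divfK //; split=> //.
  by rewrite exprMn exprVn -v12 divff // expf_neq0.
rewrite -(Qu (mu_point d_gt1 zd P)) ?mu_orbit_mu_point // mu_pointE.
have [m mE] := mu_pullback_rmorphism irr zd.
suff : vge P 1 (mu_pullback z (c v2 - y)) by rewrite vgeE // mE fmorph_eq0.
have pos v : vge P 1 (c v - c v.[a]%:P).
  have Pa1 : 1 <= P (c ('X - a%:P)) by [].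
  rewrite -poly_funB; apply: (vge_le Pa1).
  apply: (val_poly_root vP) => //; first exact: point_const.
  - exact: poly_fun_eq0.
  - by rewrite !hornerE subrr.
have Ey : mu_pullback z (c v2 - y) = (c v2 - c v2.[a]%:P) +
    c z%:P * ((c v1 - y) - (c v1 - c v1.[a]%:P)).
  rewrite mE rmorphB -!mE mu_pullback_poly_fun // mu_pullback_y // zE polyCM poly_funM.
  by rewrite opprB [c v1 - y + _]addrC addrA subrK mulrBr addrA subrK.
rewrite Ey; apply: (vgeD vP) => //; rewrite -[X in vge _ X]add0r; apply: (vgeM vP).
  apply: vge_const; last exact: poly_fun_eq0.
  exact: point_const.
apply: (vgeB vP) => //; rewrite /vge; apply/orP; right; exact: Pv.
Qed.

End SameOrbit.

Section Packet.
Variables (K : closedFieldType) (n d : nat) (f : {poly K}).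
Variable irr : monic_irreducible_poly (superelliptic_poly d f).
Local Notation L := (function_field irr).
Local Notation y := (coord_y irr).
Local Notation c := (poly_fun irr).
Local Notation ev := (bipoly_fun irr).
Hypotheses (d_gt1 : (1 < d)%N) (d_lt_n : (d < n)%N) (co_nd : coprime n d).
Hypothesis charK : [pchar K] =i pred0.
Hypothesis simple_roots_f : forall a : K, (mup a f <= 1)%N.
Hypothesis szf : size f = n.+1.
Variable O : curve_point irr.
Hypothesis O_infty : at_infinity O.
Local Notation l := ((n + d) %/ d)%N.

Lemma d_ndvd_n : ~~ (d %| n)%N.
Proof.
apply/negP => dn; have : (d %| 1)%N by rewrite -(eqP co_nd) dvdn_gcd dvdnn dn.
by rewrite dvdn1; move: d_gt1; case: d => [|[|]].
Qed.

Lemma order_bounds : (n < d * l)%N /\ (d * l < n + d)%N.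
Proof.
have nd : (n + d)%N = (d * l + n %% d)%N by rewrite {1}(divn_eq (n + d) d) modnDr mulnC.
have nd0 : (n %% d)%N != 0%N := d_ndvd_n.
have := ltn_pmod n (ltnW d_gt1); move: nd nd0; clear; lia.
Qed.

Lemma linear_form (h : L) (G : {poly {poly K}}) : h != 0 -> (size G <= d)%N -> h = ev G ->
    O h = - (d * l)%N%:Z ->
  exists (u : {poly K}) (a : K), size u = l.+1 /\ h = c u + c a%:P * y.
Proof.
move=> h0 sG hE Oh; have [lt1 lt2] := order_bounds.
have G0 : G != 0.
  by apply: contraNneq h0 => G0; rewrite hE G0 (rmorph0 (bipoly_fun irr)).
have [j [Gj Oj min_j]] := ord_infinity_sum d_gt1 szf co_nd O_infty G0 sG.
have tE := ord_infinity_term d_gt1 szf co_nd O_infty.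
have {min_j} bound i : G`_i != 0 -> (d * (size (G`_i)%R).-1 + n * i <= d * l)%N.
  by move=> Gi; have := min_j _ Gi; rewrite -Oj -hE Oh tE // lerN2 lez_nat.
have {Oj} Ej : (d * (size (G`_j)%R).-1 + n * j = d * l)%N.
  by move: Oh; rewrite hE Oj tE // => /oppr_inj [].
have G2 i : (1 < i)%N -> G`_i = 0.
  by move=> i1; apply/eqP/negPn/negP => /bound; nia.
have s1 : (size (G`_1)%R <= 1)%N.
  have [->|/bound] := eqVneq G`_1 0; first by rewrite size_poly0.
  by move=> b1; nia.
exists G`_0, (G`_1)`_0; split.
  case: j Gj Ej => [|[|j]] Gj Ej.
  - rewrite muln0 addn0 in Ej; rewrite polySpred //; congr _.+1.
    by apply/eqP; rewrite -(eqn_pmul2l (ltnW d_gt1)) Ej.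
  - have := d_ndvd_n; have : (d %| d * (size (G`_1)%R).-1 + n * 1)%N by rewrite Ej dvdn_mulr.
    by rewrite muln1 dvdn_addr ?dvdn_mulr // => ->.
  - by rewrite G2 // eqxx in Gj.
have GE : G = (G`_0)%:P + (G`_1)%:P * 'X.
  apply/polyP => -[|[|i]]; rewrite coefD coefC coefMX /= ?coefC ?addr0 ?add0r //.
  by rewrite G2.
by rewrite hE {1}GE bipoly_funD bipoly_funM -!poly_funE // bipoly_funX -(size1_polyC s1).
Qed.

(* [v ^+ d - f] is, up to sign, the norm of [c v - y], whose only zero is P;
   hence its only root is b, and it has degree [d * l]. *)
Lemma packet_equation (A : set (curve_point irr)) : torsion_packet O (d * l) A ->
  exists (P : curve_point irr) (b : K) (v : {poly K}) (alpha : K),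
  [/\ A = mu_orbit P, size v = l.+1, f = v ^+ d + alpha *: ('X - b%:P) ^+ (d * l),
   0 < P (c ('X - b%:P)) & 0 < P (c v - y) /\
   forall R : curve_point irr, 0 < R (c v - y) -> R = P].
Proof.
case=> [[P AE] [P1 [P2 [AP1 AP2 P12]]] ordA].
have d_gt0 := ltnW d_gt1; have [lt1 lt2] := order_bounds.
have m_gt1 : (1 < d * l)%N by lia.
have AP : A P by rewrite AE; exists 1; [rewrite expr1n | move=> g; rewrite mu_pullback1].
have [m_gt0 mg0 ordk] := ordA P AP.
have [h h0 hE] := torsion_function mg0.
have PO : P != O.
  apply/eqP => PO; have := ordk 1%N m_gt1; rewrite mulr1n PO; apply.
  exact: jacobian_embedding0.
have Ph : P h = (d * l)%N%:Z by rewrite hE eqxx eq_sym (negPf PO) subr0 natz.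
have Oh : O h = - (d * l)%N%:Z by rewrite hE eqxx (negPf PO) sub0r mulNrn natz.
have h_zero (R : curve_point irr) : 0 < R h -> R = P.
  rewrite hE; case: eqP => [-> //|_]; case: eqP => _; rewrite ?subrr ?mul0rn //.
  by rewrite sub0r mulNrn natz oppr_gt0.
have h_reg (R : curve_point irr) b : 0 < R (c ('X - b%:P)) -> vge R 0 h.
  move=> Rb; apply: vge0P; rewrite hE; have [ORE|_] := eqVneq O R.
    move: Rb; rewrite -ORE ord_infinity_poly //.
      by rewrite size_XsubC mulr1n lt_gtF.
    by rewrite polyXsubC_eq0.
  by rewrite subr0; case: eqP => _; rewrite ?mul0rn // natz.
have f0 : f != 0 by rewrite -size_poly_eq0 szf.
have [G sG hG] := integral_bipoly d_gt1 charK simple_roots_f f0 h_reg.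
have [u [a [su hu]]] := linear_form h0 sG hG Oh.
have AmuP R : A R -> exists (z : K) (zd : z ^+ d = 1), R = mu_point d_gt1 zd P.
  by rewrite AE => -[z zd RE]; exists z, zd; apply: point_ext => g; rewrite RE.
have a0 : a != 0.
  apply/eqP => a0; apply: P12.
  have AR R : A R -> R = P.
    move=> /AmuP[z [zd ->]]; apply: h_zero; rewrite mu_pointE hu a0.
    rewrite /= polyC0 rmorph0 mul0r addr0 mu_pullback_poly_fun //.
    by move: Ph; rewrite hu a0 polyC0 rmorph0 mul0r addr0 => ->.
  by rewrite (AR _ AP1) (AR _ AP2).
pose v := (- a^-1) *: u; pose w := c v - y.
have sv : size v = l.+1 by rewrite size_scale ?oppr_eq0 ?invr_eq0.
have hw : h = c (- a)%:P * w.
  rewrite hu /w mulrBr -poly_funM mul_polyC scalerA mulrNN divff // scale1r.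
  by rewrite polyCN (rmorphN c) mulNr opprK.
have ca0 : c (- a)%:P != 0 by rewrite poly_fun_eq0 polyC_eq0 oppr_eq0.
have w0 : w != 0 by apply: contraNneq h0 => w0; rewrite hw w0 mulr0.
have Rw (R : curve_point irr) : R w = R h.
  by rewrite hw (valgM (point_valuation R)) // point_const ?oppr_eq0 // add0r.
have sN : size (v ^+ d - f) = (d * l).+1.
  have v0 : v != 0 by rewrite -size_poly_eq0 sv.
  have svd : size (v ^+ d) = (d * l).+1.
    by rewrite (polySpred (expf_neq0 d v0)) size_exp sv mulnC.
  by rewrite size_polyDl // size_polyN svd szf ltnS.
have N_root b : root (v ^+ d - f) b -> 0 < P (c ('X - b%:P)).
  move=> rb; have [R Rb] := point_over_exists irr b d_gt1 charK simple_roots_f f0.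
  have [z zP] := primitive_root_exists d_gt0 charK.
  have zd i : (z ^+ i) ^+ d = 1 by rewrite exprAC (prim_expr_order zP) expr1n.
  have y0 : y != 0 := coord_y_neq0 irr d_gt1 szf.
  have muw i : mu_pullback (z ^+ i) w = c v - c (z ^+ i)%:P * y.
    have [m mE] := mu_pullback_rmorphism irr (zd i).
    by rewrite mE rmorphB -!mE mu_pullback_poly_fun // mu_pullback_y.
  suff [i Ri] : exists i, 0 < R (mu_pullback (z ^+ i) w).
    have : mu_point d_gt1 (zd i) R = P by apply: h_zero; rewrite -Rw mu_pointE.
    by move=> <-; rewrite mu_pointE mu_pullback_poly_fun.
  apply: contrapT => noi.
  have czP : d.-primitive_root (c z%:P).
    by rewrite (fmorph_primitive_root (c \o polyC : {rmorphism K -> L})).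
  have : R (\prod_(i < d) (c v - c z%:P ^+ i * y)) <= 0.
    apply: (valg_prod_le0 (point_valuation R)) => i.
    have -> : c v - c z%:P ^+ i * y = mu_pullback (z ^+ i) w.
      by rewrite muw -poly_fun_exp -rmorphXn.
    split; first by have [m ->] := mu_pullback_rmorphism irr (zd i); rewrite fmorph_eq0.
    by rewrite leNgt; apply/negP => Ri; apply: noi; exists i.
  rewrite -(subrXX_prim _ czP y0) coord_yXd // -poly_fun_exp -poly_funB.
  have : vge R (R (c ('X - b%:P))) (c (v ^+ d - f)).
    apply: (val_poly_root (point_valuation R)) => //; first exact: point_const.
    - exact: poly_fun_eq0.
    - by apply/eqP.
  rewrite vgeE ?poly_fun_eq0 -?size_poly_eq0 ?sN // => le1 le2.
  by have := lt_le_trans Rb (le_trans le1 le2); rewrite ltxx.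
have /closed_rootP[b rb] : size (v ^+ d - f) != 1%N by rewrite sN eqSS; lia.
have Pb := N_root b rb.
have root_b b' : root (v ^+ d - f) b' -> b' = b.
  move=> /N_root Pb'; apply/eqP; apply: contraT => bb'.
  have : vge P 1 (c (b - b')%:P).
    have -> : (b - b')%:P = ('X - b'%:P) - ('X - b%:P).
      by rewrite polyCB opprB [RHS]addrC addrA subrK.
    rewrite poly_funB; apply: (vgeB (point_valuation P)).
    + by rewrite vgeE ?poly_fun_eq0 ?polyXsubC_eq0.
    + by rewrite vgeE ?poly_fun_eq0 ?polyXsubC_eq0.
  have ne : b - b' != 0 by rewrite subr_eq0 eq_sym.
  by rewrite vgeE ?poly_fun_eq0 ?polyC_eq0 // point_const.
exists P, b, v, (- lead_coef (v ^+ d - f)); split=> //; last first.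
  by split=> [|R]; rewrite Rw; [rewrite Ph ltz_nat | exact: h_zero].
have [rs Ers] := closed_field_poly_normal (v ^+ d - f).
have rsE : rs = nseq (d * l) b.
  have srs : size rs = (d * l)%N.
    have N0 : lead_coef (v ^+ d - f) != 0 by rewrite lead_coef_eq0 -size_poly_eq0 sN.
    by move: sN; rewrite {1}Ers (size_scale _ N0) size_prod_XsubC => -[].
  rewrite -srs; apply/all_pred1P/allP => b' b'rs; apply/eqP/root_b.
  by rewrite Ers rootZ ?root_prod_XsubC // lead_coef_eq0 -size_poly_eq0 sN.
rewrite scaleNr.
have E : v ^+ d - f = lead_coef (v ^+ d - f) *: ('X - b%:P) ^+ (d * l).
  by rewrite {1}Ers rsE big_nseq iter_mulr_1.
by rewrite -E opprB addrC subrK.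
Qed.

End Packet.

Theorem theorem6 (K : closedFieldType) (n d : nat)
    (d_ge2 : (2 <= d)%N) (d_lt_n : (d < n)%N) (co_nd : coprime n d)
    (charK : [pchar K] =i pred0)
    (f : {poly K}) (deg_f : size f = n.+1)
    (simple_roots_f : forall a : K, (mup a f <= 1)%N)
    (O : curve_point (superelliptic_poly_irreducible (ltnW d_ge2) deg_f co_nd))
    (O_infty : at_infinity O) :
  let l0 := ((n + d) %/ d)%N in
  let m0 := (d * l0)%N in
  (m0 <= n + l0)%N ->
  m0 <> n.+1 ->
  (exists A B, [/\ A <> B, torsion_packet O m0 A & torsion_packet O m0 B]) ->
  (d <= 5)%N
  /\ ((n < 2 * d)%N -> [/\ (d <= 4)%N, m0 = (2 * d)%N & (n <= 7)%N])
  /\ (n = 7%N -> d = 3%N)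
  /\ (n <> 5%N /\ n <> 6%N)
  /\ (n = 4%N -> d = 3%N)
  /\ (n = 9%N -> d = 4%N).
Proof.
move=> l0 m0 _ m0n [A [B [AB pA pB]]].
have [lt1 lt2] := order_bounds d_ge2 co_nd; rewrite -/l0 -/m0 in lt1 lt2.
have eqn := packet_equation d_ge2 d_lt_n co_nd charK simple_roots_f deg_f O_infty.
have [P [a [v1 [al [AE s1 f1 Pa [Pv Pu]]]]]] := eqn _ pA.
have [Q [b [v2 [be [BE s2 f2 Qb [Qv Qu]]]]]] := eqn _ pB.
have ab : a != b.
  apply/eqP => ab; apply: AB; rewrite AE BE; subst b.
  have m0_gt0 : (0 < m0)%N := leq_ltn_trans (leq0n _) lt1.
  have fa1 : f.[a] = v1.[a] ^+ d.
    by rewrite f1 !hornerE subrr expr0n gtn_eqF // mulr0 addr0.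
  have fa2 : f.[a] = v2.[a] ^+ d.
    by rewrite f2 !hornerE subrr expr0n gtn_eqF // mulr0 addr0.
  apply: (mu_orbit_eq d_ge2 _ Pa Pv _ Qu); first by rewrite -fa1 -fa2.
  by apply: contraTneq Qv => ->; rewrite (valg0 (point_valuation Q)).
have n_ge2 := leq_trans d_ge2 (ltnW d_lt_n).
have bound := two_powers_degree charK ab d_ge2 n_ge2 lt1 m0n deg_f s1 s2 f1 f2.
have d3 : d = 3%N by apply: (degree_arith d_ge2 co_nd lt1 lt2 m0n bound).
have m0E : m0 = (3 * l0)%N by rewrite /m0 d3.
have : (n.+2 = 3 * l0)%N by clearbody m0 l0; lia.
by move: d_lt_n; rewrite d3 m0E; clearbody l0; clear => n3 nE; repeat split; lia.
Qed.
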